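(* For all integrable cones $B,C,D$, the map $\Phi_{B,C,D}$, sending $f$ to $x\mapsto(y\mapsto f(x\otimes y))$, is an isomorphism in $\mathbf{ICones}$ from the integrable cone $(B\otimes C)\multimap D$ to the integrable cone $B\multimap(C\multimap D)$.
   Context: Cones. A precone is a module $P$ over $\mathbb{R}_{\ge 0}$ with $x_1+x=x_2+x\Rightarrow x_1=x_2$ and $x_1+x_2=0\Rightarrow x_1=0$, ordered by $x\le y$ iff $y=x+z$ for some $z$. A cone is a precone with $\|\cdot\|:P\to\mathbb{R}_{\ge0}$ such that $\|\lambda x\|=\lambda\|x\|$, $\|x\|=0\Rightarrow x=0$, $\|x+y\|\le\|x\|+\|y\|$, $\|x\|\le\|x+y\|$, and every increasing sequence in $\mathcal{B}P=\{x:\|x\|\le 1\}$ has a lub in $P$ lying in $\mathcal{B}P$. Continuous = monotone and preserving lubs of norm-bounded increasing sequences; $\|f\|=\sup_{x\in\mathcal{B}P}\|f(x)\|$; $P'$ = cone of linear continuous maps $P\to\mathbb{R}_{\ge0}$. Measurability. Fix a small full subcategory $\mathbf{Ar}$ of measurable spaces, closed under binary products, containing the one-point space $0$, with non-empty objects. A measurability structure on $P$ is a family $(\mathcal{M}_X)_{X\in\mathbf{Ar}}$ of sets of maps $m:X\times P\to\mathbb{R}_{\ge0}$ with $m(r,\cdot)\in P'$ such that: (i) $r\mapsto m(r,x)$ measurable into $[0,1]$ for $x\in\mathcal{B}P$; (ii) $(s,x)\mapsto m(\phi(s),x)\in\mathcal{M}_Y$ for $\phi\in\mathbf{Ar}(Y,X)$;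 (iii) $\mathcal{M}_0$ separates points; (iv) $\|x\|=\sup\{m(x)/\|m\|:m\in\mathcal{M}_0\setminus\{0\}\}$. Paths of arity $X$ in $C$: bounded $\gamma:X\to C$ with $(s,r)\mapsto m(s,\gamma(r))$ measurable for all $m\in\mathcal{M}_Y$. Integral over a finite measure $\mu$: the $x$ with $m(x)=\int m(\gamma(r))\mu(dr)$ for all $m\in\mathcal{M}_0$. Integrable cone: all such integrals exist. $\mathbf{ICones}$: integrable cones, morphisms the linear, continuous, norm $\le1$, measurable (paths go to paths) and integral-preserving maps. Linear hom: for integrable cones $C,D$, $C\multimap D$ is the integrable cone whose elements are the maps $f$ with $\epsilon f\in\mathbf{ICones}(C,D)$ for some $\epsilon>0$, pointwise operations, norm $\|f\|=\sup_{x\in\mathcal{B}C}\|f(x)\|$, and tests $(r,f)\mapsto m(r,f(\gamma(r)))$ for $\gamma$ a path of arity $X$ in $C$ and $m\in\mathcal{M}^D_X$. It is functorial ($h\multimap g$ acts by $f\mapsto g\circ f\circ h$). Tensor product: for each $C$ the functor $C\multimap-$ on $\mathbf{ICones}$ has a left adjoint $-\otimes C$, extending to a bifunctor $\otimes$ with natural bijections $\Phi_{B,C,D}:\mathbf{ICones}(B\otimes C,D)\to\mathbf{ICones}(B,C\multimap D)$. For $x\in B$, $y\in C$ set $x\otimes y=\Phi_{B,C,B\otimes C}(\mathrm{id}_{B\otimes C})(x)(y)$; then $\Phi_{B,C,D}(f)(x)(y)=f(x\otimes y)$, and this formula extends $\Phi_{B,C,D}$ to all of $(B\otimes C)\multimap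 D$.
   Formalization: The tests of the linear hom are built only from paths in the unit ball of C: with arbitrary bounded paths, tests would take values above 1 on the unit ball, against axiom (i). Paths and integrals are unchanged by this rescaling. *)

(* Defs.v *)
From HB Require Import structures.
From mathcomp Require Import all_boot all_order all_algebra.
From mathcomp Require Import all_classical all_reals ereal topology normedtype sequences measure measurable_realfun lebesgue_measure lebesgue_integral.

Set Implicit Arguments.
Unset Strict Implicit.
Unset Printing Implicit Defensive.

Import Order.TTheory GRing.Theory Num.Theory.
Import numFieldNormedType.Exports.

Local Open Scope classical_set_scope.
Local Open Scope ring_scope.

(* The semiring of nonnegative reals; a module over it is an
   [lSemiModType (nnreal R)], and it is itself a cone (below). *)
Record nnreal (R : realType) : Type :=
  NNReal { nnval :> R; nnvalP : nnval \is Num.nneg }.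

HB.instance Definition _ (R : realType) := [isSub for @nnval R].
HB.instance Definition _ (R : realType) := [Choice of nnreal R by <:].
HB.instance Definition _ (R : realType) :=
  [SubChoice_isSubComNzSemiRing of nnreal R by <:].
HB.instance Definition _ (R : realType) :=
  GRing.LSemiModule.copy (nnreal R) (nnreal R)^o.

HB.mixin Record isPrecone (R : realType) P
    of GRing.LSemiModule (nnreal R) P := {
  conerI : forall x x1 x2 : P, x1 + x = x2 + x -> x1 = x2;
  cone_pos : forall x1 x2 : P, x1 + x2 = 0 -> x1 = 0
}.

#[short(type="preconeType")]
HB.structure Definition Precone (R : realType) :=
  {P of isPrecone R P & GRing.LSemiModule (nnreal R) P}.

Section PreconeOrder.
Context (R : realType) (P : preconeType R).

Definition cone_le (x y : P) : Prop := exists z, y = x + z.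

Definition cone_incr (u : nat -> P) : Prop := forall n, cone_le (u n) (u n.+1).

Definition cone_lub (u : nat -> P) (x : P) : Prop :=
  (forall n, cone_le (u n) x) /\
  (forall y, (forall n, cone_le (u n) y) -> cone_le x y).

End PreconeOrder.

HB.mixin Record isCone (R : realType) P of Precone R P := {
  (* [0 <= cnorm x] is a consequence, see [cnorm_ge0] *)
  cnorm : P -> R;
  cnormZ : forall (a : nnreal R) (x : P), cnorm (a *: x) = nnval a * cnorm x;
  cnorm_eq0 : forall x, cnorm x = 0 -> x = 0;
  cnormD : forall x y, cnorm (x + y) <= cnorm x + cnorm y;
  cnorm_leD : forall x y, cnorm x <= cnorm (x + y);
  cone_complete : forall u : nat -> P, cone_incr u ->
    (forall n, cnorm (u n) <= 1) -> exists2 x, cone_lub u x & cnorm x <= 1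
}.

#[short(type="coneType")]
HB.structure Definition Cone (R : realType) := {P of isCone R P & Precone R P}.

Section ConeMaps.
Context (R : realType) (P Q : coneType R).

Definition cone_linear (f : P -> Q) : Prop :=
  scalable f /\ {morph f : x y / x + y}.

Definition cone_continuous (f : P -> Q) : Prop :=
  (forall x y, cone_le x y -> cone_le (f x) (f y)) /\
  (forall (u : nat -> P) (M : R) (x : P), cone_incr u ->
     (forall n, cnorm (u n) <= M) -> cone_lub u x ->
     cone_lub (fun n => f (u n)) (f x)).

(* Extended-real valued, so that no boundedness assumption is hidden. *)
Definition opnorm (f : P -> Q) : \bar R :=
  ereal_sup [set (cnorm (f x))%:E | x in [set x | cnorm x <= 1]].

End ConeMaps.

Section NNReal.
Context (R : realType).
Implicit Types a b : nnreal R.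

Lemma nnval_ge0 a : 0 <= nnval a. Proof. exact: (nnvalP a). Qed.

Definition nn (x : R) (x0 : 0 <= x) : nnreal R := NNReal x0.

Lemma nnvalD a b : nnval (a + b) = nnval a + nnval b. Proof. exact: (raddfD val). Qed.
Lemma nnvalM a b : nnval (a * b) = nnval a * nnval b. Proof. exact: (rmorphM val). Qed.
Lemma nnvalZ a b : nnval (a *: b) = nnval a * nnval b. Proof. exact: (rmorphM val). Qed.
Lemma nnval0 : nnval (0 : nnreal R) = 0. Proof. exact: (raddf0 val). Qed.
Lemma nnval1 : nnval (1 : nnreal R) = 1. Proof. exact: (rmorph1 val). Qed.
Lemma nnval_inj : injective (@nnval R). Proof. exact: val_inj. Qed.

Fact nn_conerI (x x1 x2 : nnreal R) : x1 + x = x2 + x -> x1 = x2.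
Proof. by move/(congr1 (@nnval R)); rewrite !nnvalD => /addIr/nnval_inj. Qed.

Fact nn_pos (x1 x2 : nnreal R) : x1 + x2 = 0 -> x1 = 0.
Proof.
move/(congr1 (@nnval R)); rewrite nnvalD nnval0 => /eqP.
by rewrite paddr_eq0 ?nnval_ge0// => /andP[/eqP h _]; apply: nnval_inj; rewrite h nnval0.
Qed.

HB.instance Definition _ := isPrecone.Build R (nnreal R) nn_conerI nn_pos.

Lemma nn_leP a b : cone_le a b <-> nnval a <= nnval b.
Proof.
split=> [[c ->]|ab]; first by rewrite nnvalD lerDl nnval_ge0.
have h : 0 <= nnval b - nnval a by rewrite subr_ge0.
by exists (nn h); apply: nnval_inj; rewrite nnvalD /= addrC subrK.
Qed.

Fact nn_normZ a b : nnval (a *: b) = nnval a * nnval b. Proof. exact: nnvalZ. Qed.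
Fact nn_norm_eq0 a : nnval a = 0 -> a = 0.
Proof. by move=> h; apply: nnval_inj; rewrite h nnval0. Qed.
Fact nn_normD a b : nnval (a + b) <= nnval a + nnval b. Proof. by rewrite nnvalD. Qed.
Fact nn_norm_leD a b : nnval a <= nnval (a + b).
Proof. by rewrite nnvalD lerDl nnval_ge0. Qed.

Lemma nn_lub (u : nat -> nnreal R) (M : R) : (forall n, nnval (u n) <= M) ->
  exists2 x, cone_lub u x & nnval x <= M.
Proof.
move=> uM; set A := [set nnval (u n) | n in setT].
have hA : has_sup A.
  by split; [exists (nnval (u 0%N)), 0%N|exists M => _ [n _ <-]].
have ub n : nnval (u n) <= sup A by apply: ub_le_sup; [exact: hA.2|exists n].
have s0 : 0 <= sup A by apply: le_trans (ub 0%N); exact: nnval_ge0.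
exists (nn s0); last first.
  by apply: ge_sup; [exact: hA.1|move=> _ [n _ <-]].
split=> [n|y hy]; apply/nn_leP => //=.
by apply: ge_sup; [exact: hA.1|move=> _ [n _ <-]; exact/nn_leP].
Qed.

Fact nn_complete (u : nat -> nnreal R) : cone_incr u ->
  (forall n, nnval (u n) <= 1) -> exists2 x, cone_lub u x & nnval x <= 1.
Proof. by move=> _; exact: nn_lub. Qed.

HB.instance Definition _ := isCone.Build R (nnreal R)
  nn_normZ nn_norm_eq0 nn_normD nn_norm_leD nn_complete.

End NNReal.

(* A small full subcategory of measurable spaces: its morphisms are all the
   measurable functions between its objects. Objects are non-empty because
   [measurableType] is pointed. Closure under products is up to measurable
   isomorphism: [ar_prod X Y] is isomorphic to the product space of [X] and
   [Y]. *)
Record arity_cat := ArityCat {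
  ar_ob : Type;
  ar_disp : ar_ob -> measure_display;
  ar_sp :> forall X : ar_ob, measurableType (ar_disp X);
  ar_one : ar_ob;
  ar_pt : ar_sp ar_one;
  ar_ptE : forall r : ar_sp ar_one, r = ar_pt;
  ar_prod : ar_ob -> ar_ob -> ar_ob;
  ar_pair : forall X Y, ar_sp X * ar_sp Y -> ar_sp (ar_prod X Y);
  ar_unpair : forall X Y, ar_sp (ar_prod X Y) -> ar_sp X * ar_sp Y;
  ar_pairK : forall X Y, cancel (@ar_pair X Y) (@ar_unpair X Y);
  ar_unpairK : forall X Y, cancel (@ar_unpair X Y) (@ar_pair X Y);
  ar_pair_mfun : forall X Y, measurable_fun setT (@ar_pair X Y);
  ar_unpair_mfun : forall X Y, measurable_fun setT (@ar_unpair X Y)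
}.

Definition dual_cone (R : realType) (P : coneType R) : set (P -> nnreal R) :=
  [set f | cone_linear f /\ cone_continuous f].

HB.mixin Record hasTests (R : realType) (Ar : arity_cat) P of Cone R P := {
  test : forall X : ar_ob Ar, set (Ar X -> P -> nnreal R);
  test_dual : forall X m, test X m -> forall r, dual_cone (m r);
  test_meas : forall X m, test X m -> forall x : P, cnorm x <= 1 ->
    measurable_fun setT (fun r => nnval (m r x)) /\
    (forall r, nnval (m r x) <= 1);
  test_comp : forall X Y (phi : Ar Y -> Ar X), measurable_fun setT phi ->
    forall m, test X m -> test Y (fun s x => m (phi s) x);
  test_sep : forall x y : P,
    (forall m, test (ar_one Ar) m -> m (ar_pt Ar) x = m (ar_pt Ar) y) -> x = y;
  (* This is a bounded set of reals by [test_meas]. If no test of arity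
     [ar_one] is nonzero, it is empty and its [sup] is 0. *)
  test_norm : forall x : P,
    cnorm x = sup [set nnval (m (ar_pt Ar) x) / fine (opnorm (m (ar_pt Ar)))
                  | m in [set m | test (ar_one Ar) m /\
                                  exists y, m (ar_pt Ar) y <> 0]]
}.

#[short(type="mconeType")]
HB.structure Definition MCone (R : realType) (Ar : arity_cat) :=
  {P of hasTests R Ar P & Cone R P}.

Arguments test {R Ar} s X.

Section Paths.
Context (R : realType) (Ar : arity_cat) (C : mconeType R Ar).

Definition is_path (X : ar_ob Ar) (g : Ar X -> C) : Prop :=
  (exists M : R, forall r, cnorm (g r) <= M) /\
  (forall (Y : ar_ob Ar) m, test C Y m ->
     measurable_fun setT (fun p : Ar Y * Ar X => nnval (m p.1 (g p.2)))).

(* [x] is unique, see [cint_uniq]. *)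
Definition is_integral (X : ar_ob Ar) (g : Ar X -> C)
    (mu : {finite_measure set (Ar X) -> \bar R}) (x : C) : Prop :=
  forall m, test C (ar_one Ar) m ->
    (nnval (m (ar_pt Ar) x))%:E = (\int[mu]_r (nnval (m (ar_pt Ar) (g r)))%:E)%E.

End Paths.

HB.mixin Record isIntegrable (R : realType) (Ar : arity_cat) P
    of MCone R Ar P := {
  integral_ex : forall (X : ar_ob Ar) (g : Ar X -> P)
    (mu : {finite_measure set (Ar X) -> \bar R}),
    is_path g -> exists x, is_integral g mu x
}.

#[short(type="iconeType")]
HB.structure Definition ICone (R : realType) (Ar : arity_cat) :=
  {P of isIntegrable R Ar P & MCone R Ar P}.

Section IConeMorphisms.
Context (R : realType) (Ar : arity_cat).

Definition pres_paths (C D : mconeType R Ar) (f : C -> D) : Prop :=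
  forall (X : ar_ob Ar) (g : Ar X -> C), is_path g -> is_path (fun r => f (g r)).

Definition pres_integrals (C D : mconeType R Ar) (f : C -> D) : Prop :=
  forall (X : ar_ob Ar) (g : Ar X -> C)
    (mu : {finite_measure set (Ar X) -> \bar R}) (x : C),
    is_path g -> is_integral g mu x -> is_integral (fun r => f (g r)) mu (f x).

Definition is_icone_mor (C D : iconeType R Ar) (f : C -> D) : Prop :=
  [/\ cone_linear f, cone_continuous f, (opnorm f <= 1)%E,
      pres_paths f & pres_integrals f].

End IConeMorphisms.
Section ConeTheory.
Context (R : realType) (P : coneType R).
Implicit Types (x y z : P) (u v : nat -> P) (a : nnreal R).

Lemma cnorm0 : cnorm (0 : P) = 0.
Proof. by rewrite -(scale0r (0 : P)) cnormZ nnval0 mul0r. Qed.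

Lemma cnorm_ge0 x : 0 <= cnorm x.
Proof. by rewrite -cnorm0 -[x in leRHS]add0r cnorm_leD. Qed.

Lemma cone_lexx x : cone_le x x. Proof. by exists 0; rewrite addr0. Qed.

Lemma cone_le_trans y x z : cone_le x y -> cone_le y z -> cone_le x z.
Proof. by move=> [a ->] [b ->]; exists (a + b); rewrite addrA. Qed.

Lemma cone_le_anti x y : cone_le x y -> cone_le y x -> x = y.
Proof.
move=> [a ->] [b h]; have : a + b = 0.
  by apply: (conerI x); rewrite add0r [LHS]addrC addrA -h.
by move=> /cone_pos ->; rewrite addr0.
Qed.

Lemma cone_le_norm x y : cone_le x y -> cnorm x <= cnorm y.
Proof. by move=> [z ->]; exact: cnorm_leD. Qed.

Lemma cone_leDr x y z : cone_le x y -> cone_le (x + z) (y + z).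
Proof. by move=> [w ->]; exists w; rewrite addrAC. Qed.

Lemma cone_leDr_inv z x y : cone_le (x + z) (y + z) -> cone_le x y.
Proof. by move=> [w h]; exists w; apply: (conerI z); rewrite h addrAC. Qed.

Lemma cone_leD x y z t : cone_le x y -> cone_le z t -> cone_le (x + z) (y + t).
Proof. by move=> [a ->] [b ->]; exists (a + b); rewrite addrACA. Qed.

Lemma cone_leZ a x y : cone_le x y -> cone_le (a *: x) (a *: y).
Proof. by move=> [w ->]; exists (a *: w); rewrite scalerDr. Qed.

Lemma cone_incr_le u m n : cone_incr u -> (m <= n)%N -> cone_le (u m) (u n).
Proof.
move=> iu /subnKC <-; elim: (n - m)%N => [|k ih]; first by rewrite addn0; exact: cone_lexx.
by rewrite addnS; exact: cone_le_trans ih (iu _).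
Qed.

Lemma cone_lub_uniq u x y : cone_lub u x -> cone_lub u y -> x = y.
Proof. by move=> [ux hx] [uy hy]; apply: cone_le_anti; [exact: hx|exact: hy]. Qed.

Lemma cone_lub_cst x : cone_lub (fun=> x) x.
Proof. by split=> [_|y /(_ 0%N)//]; exact: cone_lexx. Qed.

Lemma cone_lubDr u x y : cone_lub u x -> cone_lub (fun n => u n + y) (x + y).
Proof.
move=> [ux hx]; split=> [n|z hz]; first exact: cone_leDr.
have [w zE] : cone_le y z.
  by apply: cone_le_trans (hz 0%N); exists (u 0%N); rewrite addrC.
rewrite zE [y + w]addrC; apply: cone_leDr; apply: hx => n.
by apply: (cone_leDr_inv (z := y)); rewrite [w + y]addrC -zE.
Qed.

Lemma cone_lubD u v x y : cone_incr u -> cone_incr v ->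
  cone_lub u x -> cone_lub v y -> cone_lub (fun n => u n + v n) (x + y).
Proof.
move=> iu iv ux vy; split=> [n|z hz]; first by apply: cone_leD; [exact: ux.1|exact: vy.1].
rewrite addrC; apply: (cone_lubDr x vy).2 => m; rewrite addrC.
apply: (cone_lubDr (v m) ux).2 => n.
apply: cone_le_trans (hz (maxn n m)); apply: cone_leD; apply: cone_incr_le => //.
- exact: leq_maxl.
- exact: leq_maxr.
Qed.

Lemma nn_inv_proof a : 0 <= (nnval a)^-1.
Proof. by rewrite invr_ge0 nnval_ge0. Qed.
Definition nninv a : nnreal R := nn (nn_inv_proof a).

Lemma nn_mulVr a : 0 < nnval a -> nninv a * a = 1.
Proof. by move=> a0; apply: nnval_inj; rewrite nnvalM nnval1 /= mulVf// gt_eqF. Qed.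

Lemma cone_scaleK a x : 0 < nnval a -> nninv a *: (a *: x) = x.
Proof. by move=> a0; rewrite scalerA nn_mulVr// scale1r. Qed.

Lemma cone_scaleVK a x : 0 < nnval a -> a *: (nninv a *: x) = x.
Proof. by move=> a0; rewrite scalerA mulrC nn_mulVr// scale1r. Qed.

Lemma cone_lubZ a u x : cone_lub u x -> cone_lub (fun n => a *: u n) (a *: x).
Proof.
move=> [ux hx].
have := nnval_ge0 a; rewrite le_eqVlt => /predU1P[a0|a0].
  have -> : a = 0 by apply: nnval_inj; rewrite nnval0.
  under [fun n => _]eq_fun do rewrite scale0r.
  rewrite scale0r; exact: cone_lub_cst.
split=> [n|y hy]; first exact: cone_leZ.
rewrite -[y](cone_scaleVK _ a0); apply: cone_leZ; apply: hx => n.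
by rewrite -[u n](cone_scaleK _ a0); apply: cone_leZ.
Qed.

Lemma cone_lub_ex u (M : R) : cone_incr u -> (forall n, cnorm (u n) <= M) ->
  exists2 x, cone_lub u x & cnorm x <= M.
Proof.
move=> iu uM.
have := le_trans (cnorm_ge0 _) (uM 0%N); rewrite le_eqVlt => /predU1P[M0|M0].
  exists 0; last by rewrite cnorm0 M0.
  have u0 n : u n = 0 by apply: cnorm_eq0; apply: le_anti; rewrite cnorm_ge0 M0 uM.
  by rewrite (_ : u = fun=> 0) ?funeqE//; exact: cone_lub_cst.
pose a := nn (ltW M0); have a0 : 0 < nnval a by [].
have [||x ux x1] := cone_complete (fun n => nninv a *: u n).
- by move=> n; exact: cone_leZ.
- by move=> n; rewrite cnormZ /= ler_pdivrMl// mulr1.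
exists (a *: x); last by rewrite cnormZ /= ger_pMr.
have := cone_lubZ a ux; rewrite (_ : (fun n => _) = u)// funeqE => n.
exact: cone_scaleVK.
Qed.

Lemma cone_lub_norm u (M : R) x : cone_incr u -> (forall n, cnorm (u n) <= M) ->
  cone_lub u x -> cnorm x <= M.
Proof. by move=> iu uM ux; have [y uy yM] := cone_lub_ex iu uM; rewrite (cone_lub_uniq ux uy). Qed.

End ConeTheory.

Section NNLim.
Context (R : realType).
Implicit Types (u : nat -> nnreal R) (a b : nnreal R).

Lemma nn_incr u : cone_incr u -> {homo (fun n => nnval (u n)) : m n / (m <= n)%N >-> m <= n}.
Proof. by move=> iu m n mn; apply/nn_leP; exact: cone_incr_le. Qed.

Lemma nn_lub_cvg u a : cone_incr u -> cone_lub u a ->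
  (fun n => nnval (u n)) @ \oo --> nnval a.
Proof.
move=> iu [ua ha].
have -> : nnval a = sup (range (fun n => nnval (u n))).
  have hs : has_sup (range (fun n => nnval (u n))).
    split; first by exists (nnval (u 0%N)), 0%N.
    by exists (nnval a) => _ [n _ <-]; exact/nn_leP.
  apply: le_anti; rewrite ge_sup ?andbT//; first last.
  - by move=> _ [n _ <-]; exact/nn_leP.
  - exact: hs.1.
  have s0 : 0 <= sup (range (fun n => nnval (u n))).
    by apply: le_trans (nnval_ge0 (u 0%N)) _; apply: ub_le_sup; [exact: hs.2|exists 0%N].
  have := ha (nn s0); rewrite nn_leP; apply => n; apply/nn_leP => /=.
  by apply: ub_le_sup; [exact: hs.2|exists n].
apply: nondecreasing_cvgn; first exact: nn_incr.
by exists (nnval a) => _ [n _ <-]; exact/nn_leP.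
Qed.

Lemma nn_cvg_lub u a : cone_incr u -> (fun n => nnval (u n)) @ \oo --> nnval a ->
  cone_lub u a.
Proof.
move=> iu ua.
have h n : nnval (u n) <= nnval a.
  rewrite -(cvg_lim _ ua)//; apply: nondecreasing_cvgn_le.
    exact: nn_incr.
  by apply/cvg_ex; exists (nnval a).
split=> [n|b hb]; apply/nn_leP; first exact: h.
rewrite -(cvg_lim _ ua)//; apply: limr_le.
  by apply/cvg_ex; exists (nnval a).
by apply: nearW => n; exact/nn_leP.
Qed.

End NNLim.

Section Linear.
Context (R : realType) (P Q : coneType R).
Implicit Types (f : P -> Q).

Lemma cone_lin0 f : cone_linear f -> f 0 = 0.
Proof. by move=> [fZ _]; rewrite -(scale0r (0 : P)) fZ scale0r. Qed.

Lemma cone_lin_le f : cone_linear f -> forall x y, cone_le x y -> cone_le (f x) (f y).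
Proof. by move=> [_ fD] x y [z ->]; exists (f z); rewrite fD. Qed.

Lemma cone_lin_incr f u : cone_linear f -> cone_incr u -> cone_incr (fun n => f (u n)).
Proof. by move=> fl iu n; exact: cone_lin_le. Qed.

Definition cbounded f (K : R) := 0 <= K /\ forall x, cnorm (f x) <= K * cnorm x.

Lemma opnorm_le f (K : R) : cone_linear f -> 0 <= K ->
  (opnorm f <= K%:E)%E <-> cbounded f K.
Proof.
move=> fl K0; split=> [h|[_ h]]; last first.
  apply: ge_ereal_sup => _ [x /= x1 <-]; rewrite lee_fin.
  by apply: le_trans (h x) _; exact: ler_piMr.
split=> // x; have := cnorm_ge0 x; rewrite le_eqVlt => /predU1P[x0|x0].
  by rewrite (cnorm_eq0 _ (esym x0)) cone_lin0// !cnorm0 mulr0.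
pose a := nn (ltW x0).
have : ((cnorm (f (nninv a *: x)))%:E <= K%:E)%E.
  apply: le_trans h; apply: ereal_sup_ubound; exists (nninv a *: x) => //=.
  by rewrite cnormZ /= mulVf// gt_eqF.
by rewrite fl.1 lee_fin cnormZ /= ler_pdivrMl// mulrC.
Qed.

Lemma opnorm_ge0 f : (0 <= opnorm f)%E.
Proof.
apply: le_trans (_ : (cnorm (f 0))%:E <= _)%E; first by rewrite lee_fin cnorm_ge0.
by apply: ereal_sup_ubound; exists 0 => //=; rewrite cnorm0.
Qed.

Lemma opnorm_fin f (K : R) : cone_linear f -> cbounded f K -> opnorm f \is a fin_num.
Proof.
move=> fl fK; rewrite ge0_fin_numE ?opnorm_ge0//.
by apply: le_lt_trans (_ : K%:E < +oo)%E; [apply/opnorm_le => //; exact: fK.1|exact: ltry].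
Qed.

Lemma fine_opnorm_ge0 f : 0 <= fine (opnorm f).
Proof. exact: fine_ge0 (opnorm_ge0 f). Qed.

Lemma opnorm_bound f K : cone_linear f -> cbounded f K -> cbounded f (fine (opnorm f)).
Proof.
move=> fl fK; apply/opnorm_le => //; first exact: fine_opnorm_ge0.
by rewrite fineK//; exact: opnorm_fin fK.
Qed.

Lemma fine_opnorm_le f K : cone_linear f -> cbounded f K -> fine (opnorm f) <= K.
Proof.
move=> fl fK; rewrite -lee_fin fineK; last exact: opnorm_fin fK.
by apply/opnorm_le => //; exact: fK.1.
Qed.

End Linear.

Section MConeTheory.
Context (R : realType) (Ar : arity_cat) (C : mconeType R Ar).
Implicit Types (x y z : C) (X Y Z : ar_ob Ar).

Lemma test_at X m (r : Ar X) : test C X m -> test C (ar_one Ar) (fun=> m r).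
Proof.
move=> tm; apply: (test_comp X (ar_one Ar) (fun=> r)) tm; exact: measurable_cst.
Qed.

Lemma test_bound X m (r : Ar X) : test C X m -> cbounded (m r) 1.
Proof.
move=> tm; have [ml _] := test_dual X m tm r.
apply/opnorm_le => //; apply: ge_ereal_sup => _ [x /= x1 <-].
by rewrite lee_fin; have [_ ->] := test_meas X m tm x x1.
Qed.

Lemma test_le X m (r : Ar X) x : test C X m -> nnval (m r x) <= cnorm x.
Proof. by move=> /(test_bound r)[_ /(_ x)]; rewrite mul1r. Qed.

Lemma cnorm_le_test x (K : R) : 0 <= K ->
  (forall m, test C (ar_one Ar) m ->
     nnval (m (ar_pt Ar) x) <= fine (opnorm (m (ar_pt Ar))) * K) -> cnorm x <= K.
Proof.
move=> K0 h; rewrite test_norm; set A := [set _ | _ in _].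
have [->|/set0P A0] := eqVneq A set0; first by rewrite sup0.
apply: ge_sup => // _ [m [tm [y my]] <-].
have ml := (test_dual _ _ tm (ar_pt Ar)).1.
have hb := opnorm_bound ml (test_bound (ar_pt Ar) tm).
have op0 : 0 < fine (opnorm (m (ar_pt Ar))).
  rewrite lt_def hb.1 andbT; apply/eqP => op0; apply: my.
  apply: nnval_inj; apply: le_anti; rewrite nnval_ge0 andbT nnval0.
  by have := hb.2 y; rewrite op0 mul0r.
by rewrite ler_pdivrMr// mulrC h.
Qed.

Lemma test_opnorm X m (r : Ar X) x : test C X m ->
  nnval (m r x) <= fine (opnorm (m r)) * cnorm x.
Proof.
move=> tm; have ml := (test_dual _ _ tm r).1.
exact: (opnorm_bound ml (test_bound r tm)).2.
Qed.

Lemma path_cst X x : is_path (fun _ : Ar X => x).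
Proof.
split=> [|Y m tm]; first by exists (cnorm x).
have [x0|x0] := eqVneq (cnorm x) 0.
  rewrite (cnorm_eq0 _ x0).
  rewrite (_ : (fun _ => _) = cst 0) ?measurable_cst//; last first.
    by rewrite funeqE => p /=; rewrite (cone_lin0 (test_dual _ _ tm _).1) nnval0.
have x1 : 0 < cnorm x by rewrite lt_def x0 cnorm_ge0.
pose a := nn (ltW x1).
have h : measurable_fun setT (fun r => nnval (m r (nninv a *: x))).
  by apply: (test_meas _ _ tm _ _).1; rewrite cnormZ /= mulVf.
rewrite (_ : (fun _ => _) =
   (fun p => cnorm x * nnval (m p.1 (nninv a *: x)))); last first.
  rewrite funeqE => p; rewrite (test_dual _ _ tm _).1.1 nnvalZ /=.
  by rewrite mulrA mulfV// mul1r.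
apply: measurable_funM; first exact: measurable_cst.
by apply: measurableT_comp h _; exact: measurable_fst.
Qed.

Lemma path_comp X Y (phi : Ar Y -> Ar X) (g : Ar X -> C) :
  measurable_fun setT phi -> is_path g -> is_path (g \o phi).
Proof.
move=> mphi [[M gM] gm]; split=> [|Z m tm]; first by exists M => r /=.
apply: (measurableT_comp (gm _ _ tm) (g := fun p => (p.1, phi p.2))).
apply: measurable_fun_pair; first exact: measurable_fst.
by apply: measurableT_comp mphi _; exact: measurable_snd.
Qed.

Lemma path_meas X Y Z (g : Ar X -> C) m (phi : Ar Z -> Ar Y) (psi : Ar Z -> Ar X) :
  is_path g -> test C Y m -> measurable_fun setT phi -> measurable_fun setT psi ->
  measurable_fun setT (fun r => nnval (m (phi r) (g (psi r)))).
Proof.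
move=> [_ gm] tm mphi mpsi.
apply: (measurableT_comp (gm _ _ tm) (g := fun r => (phi r, psi r))).
exact: measurable_fun_pair.
Qed.

Lemma path_diag X (g : Ar X -> C) m : is_path g -> test C X m ->
  measurable_fun setT (fun r => nnval (m r (g r))).
Proof. by move=> gp tm; apply: (path_meas gp tm (phi := id) (psi := id)). Qed.

Lemma path_at X Y (s : Ar Y) (g : Ar X -> C) m : is_path g -> test C Y m ->
  measurable_fun setT (fun r => nnval (m s (g r))).
Proof.
by move=> gp tm; apply: (path_meas gp tm (phi := fun=> s) (psi := id)).
Qed.

Lemma pathZ X (a : nnreal R) (g : Ar X -> C) : is_path g -> is_path (fun r => a *: g r).
Proof.
move=> [[M gM] gm]; split=> [|Y m tm].
  by exists (nnval a * M) => r; rewrite cnormZ ler_wpM2l// nnval_ge0.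
rewrite (_ : (fun _ => _) = (fun p => nnval a * nnval (m p.1 (g p.2)))).
  by apply: measurable_funM; [exact: measurable_cst|exact: gm].
by rewrite funeqE => p; rewrite (test_dual _ _ tm _).1.1 nnvalZ.
Qed.

Lemma pathD X (f g : Ar X -> C) : is_path f -> is_path g -> is_path (fun r => f r + g r).
Proof.
move=> [[M fM] fm] [[N gN] gm]; split=> [|Y m tm].
  by exists (M + N) => r; apply: le_trans (cnormD _ _) _; exact: lerD.
rewrite (_ : (fun _ => _) =
    ((fun p => nnval (m p.1 (f p.2))) \+ (fun p => nnval (m p.1 (g p.2))))).
  by apply: measurable_funD; [exact: fm|exact: gm].
by rewrite funeqE => p; rewrite (test_dual _ _ tm _).1.2 nnvalD.
Qed.

Lemma pathBr X (f g h : Ar X -> C) : is_path f -> is_path g ->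
  (forall r, g r = f r + h r) -> is_path h.
Proof.
move=> [[M fM] fm] [[N gN] gm] fgh; split=> [|Y m tm].
  by exists N => r; apply: le_trans (gN r); apply: cone_le_norm; exists (f r); rewrite addrC.
rewrite (_ : (fun _ => _) =
    ((fun p => nnval (m p.1 (g p.2))) \- (fun p => nnval (m p.1 (f p.2))))).
  by apply: measurable_funB; [exact: gm|exact: fm].
by rewrite funeqE => p /=; rewrite fgh (test_dual _ _ tm _).1.2 nnvalD addrAC subrr add0r.
Qed.

Lemma cint_uniq X (g : Ar X -> C) (mu : {finite_measure set (Ar X) -> \bar R}) x y :
  is_integral g mu x -> is_integral g mu y -> x = y.
Proof.
move=> gx gy; apply: test_sep => m tm; apply: nnval_inj; apply: EFin_inj.
by rewrite gx// gy.
Qed.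

Lemma test_lub_eq u x y : cone_incr u -> cone_lub u x ->
  (exists M : R, forall n, cnorm (u n) <= M) ->
  (forall m, test C (ar_one Ar) m ->
    (fun n => nnval (m (ar_pt Ar) (u n))) @ \oo --> nnval (m (ar_pt Ar) y)) -> x = y.
Proof.
move=> iu ux [M uM] h; apply: test_sep => m tm; apply: nnval_inj.
have [ml mc] := test_dual _ _ tm (ar_pt Ar).
have h1 := nn_lub_cvg (cone_lin_incr ml iu) (mc.2 _ _ _ iu uM ux).
exact: (cvg_unique _ h1 (h m tm)).
Qed.

Lemma test_lub_cvg X m (r : Ar X) u x (M : R) : test C X m -> cone_incr u ->
  (forall n, cnorm (u n) <= M) -> cone_lub u x ->
  (fun n => nnval (m r (u n))) @ \oo --> nnval (m r x).
Proof.
move=> tm iu uM ux; have [ml mc] := test_dual _ _ tm r.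
exact: nn_lub_cvg (cone_lin_incr ml iu) (mc.2 _ _ _ iu uM ux).
Qed.

Section Integrals.
Context (X : ar_ob Ar) (mu : {finite_measure set (Ar X) -> \bar R}).

Lemma cint_at Y m (s : Ar Y) (g : Ar X -> C) x : test C Y m -> is_integral g mu x ->
  (nnval (m s x))%:E = (\int[mu]_r (nnval (m s (g r)))%:E)%E.
Proof. by move=> /(test_at s) tm /(_ _ tm). Qed.

Lemma path_EFin Y m (s : Ar Y) (g : Ar X -> C) : is_path g -> test C Y m ->
  measurable_fun setT (fun r => (nnval (m s (g r)))%:E).
Proof. by move=> gp tm; apply/measurable_EFinP; exact: path_at. Qed.

Lemma cintZ (a : nnreal R) (g : Ar X -> C) x : is_path g -> is_integral g mu x ->
  is_integral (fun r => a *: g r) mu (a *: x).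
Proof.
move=> gp gx m tm; have ml := (test_dual _ _ tm (ar_pt Ar)).1.
rewrite ml.1 nnvalZ EFinM (gx m tm) -ge0_integralZl_EFin ?nnval_ge0//.
- by apply: eq_integral => r _; rewrite ml.1 nnvalZ EFinM.
- by move=> r _; rewrite lee_fin nnval_ge0.
- exact: path_EFin.
Qed.

Lemma cintD (f g : Ar X -> C) x y : is_path f -> is_path g ->
  is_integral f mu x -> is_integral g mu y ->
  is_integral (fun r => f r + g r) mu (x + y).
Proof.
move=> fp gp fx gy m tm; have ml := (test_dual _ _ tm (ar_pt Ar)).1.
rewrite ml.2 nnvalD EFinD (fx m tm) (gy m tm) -ge0_integralD//.
- by apply: eq_integral => r _; rewrite ml.2 nnvalD EFinD.
- by move=> r _; rewrite lee_fin nnval_ge0.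
- exact: path_EFin.
- by move=> r _; rewrite lee_fin nnval_ge0.
- exact: path_EFin.
Qed.

Lemma cone_decomp_eq x y z : x + y = x + z -> y = z.
Proof. by rewrite ![x + _]addrC; exact: conerI. Qed.

Lemma cint_norm (g : Ar X -> C) x (K : R) : is_path g -> 0 <= K ->
  (forall r, cnorm (g r) <= K) -> is_integral g mu x ->
  cnorm x <= K * fine (mu setT).
Proof.
move=> gp K0 gK gx.
have muT : mu setT = (fine (mu setT))%:E by rewrite fineK// fin_num_measure.
apply: cnorm_le_test => [|m tm]; first by rewrite mulr_ge0// fine_ge0.
rewrite -lee_fin (gx m tm) mulrA EFinM -muT.
rewrite -(integral_cst mu measurableT).
apply: ge0_le_integral => //.
- by move=> r _; rewrite lee_fin nnval_ge0.
- exact: path_EFin.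
- move=> r _; rewrite lee_fin; apply: le_trans (test_opnorm _ _ tm) _.
  by rewrite ler_wpM2l// fine_opnorm_ge0.
Qed.

End Integrals.
End MConeTheory.

Section MonotoneConvergence.
Context (R : realType) d (T : measurableType d) (mu : {measure set T -> \bar R}).

Lemma nn_mct (h : nat -> T -> nnreal R) (l : T -> nnreal R) :
  (forall n, measurable_fun setT (fun r => nnval (h n r))) ->
  (forall r, cone_incr (fun n => h n r)) ->
  (forall r, (fun n => nnval (h n r)) @ \oo --> nnval (l r)) ->
  (fun n => \int[mu]_r (nnval (h n r))%:E)%E @ \oo -->
    (\int[mu]_r (nnval (l r))%:E)%E.
Proof.
move=> mh ih hl.
have -> : (\int[mu]_r (nnval (l r))%:E = \int[mu]_r (limn (fun n => (nnval (h n r))%:E)))%E.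
  apply: eq_integral => r _; apply/esym/cvg_lim => //.
  by apply: cvg_EFin; [exact: nearW|exact: hl].
apply: cvg_monotone_convergence => //.
- by move=> n; exact/measurable_EFinP.
- by move=> n r _; rewrite lee_fin nnval_ge0.
- by move=> r _ m n mn; rewrite lee_fin; exact: (nn_incr (ih r)).
Qed.

End MonotoneConvergence.

Section BoundedMaps.
Context (R : realType) (Ar : arity_cat) (C D : iconeType R Ar).
Implicit Types (f g h : C -> D) (X Y Z : ar_ob Ar).

Definition is_linhom f : Prop :=
  exists2 e : nnreal R, 0 < nnval e & is_icone_mor (fun x => e *: f x).

(* Characterizes [is_linhom], see [bhomP]. *)
Definition bhom f : Prop := [/\ cone_linear f, cone_continuous f,
  exists K, cbounded f K, pres_paths f & pres_integrals f].

Lemma bhomZ (a : nnreal R) f : bhom f -> bhom (fun x => a *: f x).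
Proof.
move=> [fl fc [K [K0 fK]] fp fi]; split.
- split=> [b x|x y]; first by rewrite fl.1 !scalerA mulrC.
  by rewrite fl.2 scalerDr.
- split=> [x y xy|u M x iu uM ux]; first exact/cone_leZ/fc.1.
  by apply: cone_lubZ; exact: (fc.2 _ M).
- exists (nnval a * K); split=> [|x]; first by rewrite mulr_ge0// nnval_ge0.
  by rewrite cnormZ -mulrA ler_wpM2l// nnval_ge0.
- by move=> X g gp; apply: pathZ; exact: fp.
- by move=> X g mu x gp gx; apply: cintZ; [exact: fp|exact: fi].
Qed.

Lemma bhomP f : is_linhom f <-> bhom f.
Proof.
split=> [[e e0 [fl fc f1 fp fi]]|fb].
  rewrite (_ : f = fun x => nninv e *: (e *: f x)); last first.
    by rewrite funeqE => x; rewrite cone_scaleK.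
  apply: bhomZ; split=> //; exists 1; exact/(opnorm_le fl).
have [fl fc [K [K0 fK]] fp fi] := fb.
have K1 : 0 <= (K + 1)^-1 by rewrite invr_ge0 addr_ge0.
exists (nn K1); first by rewrite /= invr_gt0 ltr_wpDl.
have [gl gc [_ _] gp gi] := bhomZ (nn K1) fb; split=> //.
apply/opnorm_le => //; split=> // x.
rewrite cnormZ /= mul1r ler_pdivrMl ?ltr_wpDl//.
by apply: le_trans (fK x) _; rewrite ler_wpM2r ?cnorm_ge0// lerDl.
Qed.

Lemma bhom0 : bhom (fun=> 0).
Proof.
split.
- by split=> [a x|x y]; rewrite ?scaler0 ?addr0.
- by split=> [x y _|u M x _ _ _]; [exact: cone_lexx|exact: cone_lub_cst].
- by exists 0; split=> // x; rewrite cnorm0 mul0r.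
- by move=> X g _; exact: path_cst.
- move=> X g mu x _ _ m tm; rewrite (cone_lin0 (test_dual _ _ tm _).1) nnval0.
  by rewrite integral0.
Qed.

Lemma bhomD f g : bhom f -> bhom g -> bhom (fun x => f x + g x).
Proof.
move=> [fl fc [K [K0 fK]] fp fi] [gl gc [L [L0 gL]] gp gi]; split.
- split=> [b x|x y]; first by rewrite fl.1 gl.1 scalerDr.
  by rewrite fl.2 gl.2 addrACA.
- split=> [x y xy|u M x iu uM ux].
    by apply: cone_leD; [exact: fc.1|exact: gc.1].
  apply: cone_lubD; [exact: cone_lin_incr|exact: cone_lin_incr| |].
    exact: (fc.2 _ M).
  exact: (gc.2 _ M).
- exists (K + L); split=> [|x]; first exact: addr_ge0.
  by apply: le_trans (cnormD _ _) _; rewrite mulrDl lerD.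
- by move=> X p pp; apply: pathD; [exact: fp|exact: gp].
- move=> X p mu x pp px.
  by apply: cintD; [exact: fp|exact: gp|exact: fi|exact: gi].
Qed.

Lemma bhom_sub f g h : bhom f -> bhom g -> (forall x, g x = f x + h x) -> bhom h.
Proof.
move=> [fl fc [K [K0 fK]] fp fi] [gl gc [L [L0 gL]] gp gi] gE.
have hl : cone_linear h.
  split=> [b x|x y].
    apply: (@cone_decomp_eq _ _ _ (f (b *: x))).
    by rewrite -gE fl.1 gl.1 gE scalerDr.
  apply: (@cone_decomp_eq _ _ _ (f (x + y))).
  by rewrite -gE gl.2 fl.2 addrACA -!gE.
have hb : cbounded h L.
  split=> // x; apply: le_trans (gL x); apply: cone_le_norm.
  by exists (f x); rewrite addrC.
split=> //.
- split=> [x y|u M x iu uM ux]; first exact: cone_lin_le.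
  have ihu := cone_lin_incr hl iu; have ifu := cone_lin_incr fl iu.
  have [n|y uy _] := cone_lub_ex (M := L * M) ihu.
    by apply: le_trans (hb.2 _) _; exact: ler_wpM2l.
  suff <- : y = h x by [].
  apply: (@cone_decomp_eq _ _ _ (f x)); rewrite -gE.
  apply: (cone_lub_uniq _ (gc.2 _ M _ iu uM ux)).
  rewrite (_ : (fun n => g (u n)) = (fun n => f (u n) + h (u n))).
    by apply: cone_lubD => //; exact: (fc.2 _ M).
  by rewrite funeqE => n; rewrite gE.
- by exists L.
- by move=> X p pp; apply: (pathBr (fp _ _ pp) (gp _ _ pp)) => r.
- move=> X p mu x pp px.
  have hpp : is_path (fun r => h (p r)).
    by apply: (pathBr (fp _ _ pp) (gp _ _ pp)) => r.
  have [y hy] := integral_ex X _ mu hpp.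
  suff <- : y = h x by [].
  apply: (@cone_decomp_eq _ _ _ (f x)); rewrite -gE.
  apply: (cint_uniq _ (gi _ _ _ _ pp px)).
  rewrite (_ : (fun n => g (p n)) = (fun n => f (p n) + h (p n))).
    by apply: cintD => //; [exact: fp|exact: fi].
  by rewrite funeqE => r; rewrite gE.
Qed.

Lemma bhom_lub (u : nat -> C -> D) (K : R) f :
  (forall n, bhom (u n)) -> (forall x, cone_incr (fun n => u n x)) ->
  (forall n, cbounded (u n) K) -> (forall x, cone_lub (fun n => u n x) (f x)) ->
  bhom f /\ cbounded f K.
Proof.
move=> ub ui uK uf.
have K0 : 0 <= K by exact: (uK 0%N).1.
have uKx x n : cnorm (u n x) <= K * cnorm x := (uK n).2 x.
have fl : cone_linear f.
  split=> [a x|x y]; apply: (cone_lub_uniq (uf _)).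
    rewrite (_ : (fun n => _) = (fun n => a *: u n x)); first exact: cone_lubZ.
    by rewrite funeqE => n; have [ul _ _ _ _] := ub n; rewrite ul.1.
  rewrite (_ : (fun n => _) = (fun n => u n x + u n y)); first exact: cone_lubD.
  by rewrite funeqE => n; have [ul _ _ _ _] := ub n; rewrite ul.2.
have fK : cbounded f K.
  split=> // x; apply: (cone_lub_norm (ui x) _ (uf x)) => n; exact: (uK n).2.
have fp : pres_paths f.
  move=> X p pp; split=> [|Y m tm].
    have [[M pM] _] := pp; exists (K * M) => r.
    by apply: le_trans (fK.2 _) _; exact: ler_wpM2l.
  apply: (measurable_fun_cvg (h := fun n q => nnval (m q.1 (u n (p q.2))))).
    by move=> n; have [_ _ _ up _] := ub n; exact: (up _ _ pp).2.
  move=> q _; exact: (test_lub_cvg tm (ui (p q.2)) (uKx (p q.2)) (uf (p q.2))).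
split=> //; split=> //; last 1 first.
- move=> X p mu x pp px m tm.
  have h1 : (fun n => (nnval (m (ar_pt Ar) (u n x)))%:E) @ \oo -->
            (nnval (m (ar_pt Ar) (f x)))%:E.
    apply: cvg_EFin; first exact: nearW.
    exact: (test_lub_cvg tm (ui x) (uKx x) (uf x)).
  have h2 : (fun n => (nnval (m (ar_pt Ar) (u n x)))%:E) @ \oo -->
            (\int[mu]_r (nnval (m (ar_pt Ar) (f (p r))))%:E)%E.
    rewrite (_ : (fun n => _) =
       (fun n => \int[mu]_r (nnval (m (ar_pt Ar) (u n (p r))))%:E)%E); last first.
      by rewrite funeqE => n; have [_ _ _ _ uint] := ub n; exact: (uint _ _ _ _ pp px).
    apply: nn_mct.
    + by move=> n; have [_ _ _ up _] := ub n; apply: (path_at _ (up _ _ pp) tm).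
    + by move=> r; apply: cone_lin_incr => //; exact: (test_dual _ _ tm _).1.
    + by move=> r; exact: (test_lub_cvg tm (ui _) (uKx _) (uf _)).
  exact: (cvg_unique _ h1 h2).
- split=> [x y|v M x iv vM vx]; first exact: cone_lin_le.
  split=> [n|y hy]; first by apply: cone_lin_le => //; exact: vx.1.
  apply: (uf x).2 => n; have [_ uc _ _ _] := ub n.
  apply: (uc.2 _ M _ iv vM vx).2 => k; apply: cone_le_trans (hy k).
  exact: (uf (v k)).1.
- by exists K.
Qed.

Lemma bhom_int X (e : Ar X -> C -> D) (mu : {finite_measure set (Ar X) -> \bar R})
    (K : R) f :
  (forall r, bhom (e r)) -> (forall r, cbounded (e r) K) ->
  (forall Y (g : Ar Y -> C), is_path g -> forall Z m, test D Z m ->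
     measurable_fun setT
       (fun p : (Ar Z * Ar Y) * Ar X => nnval (m p.1.1 (e p.2 (g p.1.2))))) ->
  (forall x, is_integral (fun r => e r x) mu (f x)) -> bhom f.
Proof.
move=> eb eK em ef.
have K0 : 0 <= K by exact: (eK point).1.
have ep x : is_path (fun r => e r x).
  split; first by exists (K * cnorm x) => r; exact: (eK r).2.
  move=> Z m tm.
  apply: (measurableT_comp (em _ _ (path_cst (ar_one Ar) x) _ _ tm)
     (g := fun q : Ar Z * Ar X => ((q.1, ar_pt Ar), q.2))).
  apply: measurable_fun_pair; last exact: measurable_snd.
  by apply: measurable_fun_pair; [exact: measurable_fst|exact: measurable_cst].
have fl : cone_linear f.
  split=> [a x|x y]; apply: (cint_uniq (ef _)).
    rewrite (_ : (fun r => _) = (fun r => a *: e r x)); first exact: cintZ.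
    by rewrite funeqE => r; have [el _ _ _ _] := eb r; rewrite el.1.
  rewrite (_ : (fun r => _) = (fun r => e r x + e r y)); first exact: cintD.
  by rewrite funeqE => r; have [el _ _ _ _] := eb r; rewrite el.2.
have fK : cbounded f (K * fine (mu setT)).
  split=> [|x]; first by rewrite mulr_ge0// fine_ge0.
  rewrite mulrAC; apply: (cint_norm (ep x) _ _ (ef x)).
    by rewrite mulr_ge0// cnorm_ge0.
  by move=> r; exact: (eK r).2.
have fp : pres_paths f.
  move=> Y p pp; split=> [|Z m tm].
    have [[M pM] _] := pp; exists (K * fine (mu setT) * M) => r.
    by apply: le_trans (fK.2 _) _; apply: ler_wpM2l => //; exact: fK.1.
  apply/measurable_EFinP.
  rewrite (_ : _ \o _ = fun q : Ar Z * Ar Y =>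
     (\int[mu]_r (nnval (m q.1 (e r (p q.2))))%:E)%E); last first.
    by rewrite funeqE => q /=; exact: (cint_at _ tm (ef _)).
  apply: (measurable_fun_fubini_tonelli_F
    (fun z : (Ar Z * Ar Y) * Ar X => (nnval (m z.1.1 (e z.2 (p z.1.2))))%:E)).
    by apply/measurable_EFinP; exact: (em _ _ pp _ _ tm).
  by move=> z; rewrite lee_fin nnval_ge0.
split=> //; last 2 first.
- by exists (K * fine (mu setT)).
- move=> Y p nu x pp px m tm.
  rewrite (cint_at (ar_pt Ar) tm (ef _)).
  transitivity (\int[mu]_r \int[nu]_t (nnval (m (ar_pt Ar) (e r (p t))))%:E)%E.
    apply: eq_integral => r _; have [_ _ _ _ ei] := eb r.
    exact: (ei _ _ _ _ pp px).
  transitivity (\int[nu]_t \int[mu]_r (nnval (m (ar_pt Ar) (e r (p t))))%:E)%E; last first.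
    by apply: eq_integral => t _; rewrite -(cint_at (ar_pt Ar) tm (ef _)).
  apply: (fubini_tonelli (m1 := mu) (m2 := nu)
    (fun z : Ar X * Ar Y => (nnval (m (ar_pt Ar) (e z.1 (p z.2))))%:E)).
    apply/measurable_EFinP.
    apply: (measurableT_comp (em _ _ pp _ _ tm)
       (g := fun z : Ar X * Ar Y => ((ar_pt Ar, z.2), z.1))).
    apply: measurable_fun_pair; last exact: measurable_fst.
    by apply: measurable_fun_pair; [exact: measurable_cst|exact: measurable_snd].
  by move=> z; rewrite lee_fin nnval_ge0.
- split=> [x y|v M x iv vM vx]; first exact: cone_lin_le.
  have ifv := cone_lin_incr fl iv.
  have fvM n : cnorm (f (v n)) <= K * fine (mu setT) * M.
    by apply: le_trans (fK.2 _) _; apply: ler_wpM2l => //; exact: fK.1.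
  have [y vy _] := cone_lub_ex ifv fvM.
  suff <- : y = f x by [].
  apply: (test_lub_eq ifv vy); first by exists (K * fine (mu setT) * M).
  move=> m tm.
  suff : (fun n => (nnval (m (ar_pt Ar) (f (v n))))%:E) @ \oo -->
            (nnval (m (ar_pt Ar) (f x)))%:E by move/fine_cvgP => [].
  rewrite (ef _ m tm) (_ : (fun n => _) =
     (fun n => \int[mu]_r (nnval (m (ar_pt Ar) (e r (v n))))%:E)%E); last first.
    by rewrite funeqE => n; exact: ef.
  have el r : cone_linear (e r) by have [] := eb r.
  apply: nn_mct.
  + by move=> n; exact: path_at.
  + move=> r; apply: cone_lin_incr; first exact: (test_dual _ _ tm _).1.
    exact: cone_lin_incr.
  + move=> r; have [_ ec _ _ _] := eb r.
    apply: (test_lub_cvg (M := K * M) tm).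
    * exact: cone_lin_incr.
    * by move=> n; apply: le_trans ((eK r).2 _) _; exact: ler_wpM2l.
    * exact: (ec.2 _ M).
Qed.

End BoundedMaps.

Record linhom (R : realType) (Ar : arity_cat) (C D : iconeType R Ar) : Type :=
  LinHom { lfun :> C -> D; lfunP : is_linhom lfun }.

Section LinHom.
Context (R : realType) (Ar : arity_cat) (C D : iconeType R Ar).
Local Notation H := (linhom C D).
Implicit Types (f g h : H) (X Y Z : ar_ob Ar).

Lemma linhom_ext f g : (forall x, f x = g x) -> f = g.
Proof.
case: f g => [f fP] [g gP] /= /funext fg; case: _ / fg gP => gP.
by congr LinHom; exact: Prop_irrelevance.
Qed.

Lemma lfun_bhom f : bhom f. Proof. exact/bhomP/lfunP. Qed.

Definition bhom_lin (f : C -> D) (fb : bhom f) : H := LinHom ((bhomP f).2 fb).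

HB.instance Definition _ := gen_eqMixin H.
HB.instance Definition _ := gen_choiceMixin H.

Definition linhom_zero : H := bhom_lin (bhom0 C D).
Definition linhom_add f g : H := bhom_lin (bhomD (lfun_bhom f) (lfun_bhom g)).
Definition linhom_scale (a : nnreal R) f : H := bhom_lin (bhomZ a (lfun_bhom f)).

Fact linhom_addA : associative linhom_add.
Proof. by move=> f g h; apply: linhom_ext => x /=; rewrite addrA. Qed.
Fact linhom_addC : commutative linhom_add.
Proof. by move=> f g; apply: linhom_ext => x /=; rewrite addrC. Qed.
Fact linhom_add0 : left_id linhom_zero linhom_add.
Proof. by move=> f; apply: linhom_ext => x /=; rewrite add0r. Qed.

HB.instance Definition _ :=
  GRing.isNmodule.Build H linhom_addA linhom_addC linhom_add0.

Fact linhom_scaleA (a b : nnreal R) f :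
  linhom_scale a (linhom_scale b f) = linhom_scale (a * b) f.
Proof. by apply: linhom_ext => x /=; rewrite scalerA. Qed.
Fact linhom_scale0 f : linhom_scale 0 f = 0.
Proof. by apply: linhom_ext => x /=; rewrite scale0r. Qed.
Fact linhom_scale1 : left_id 1 linhom_scale.
Proof. by move=> f; apply: linhom_ext => x /=; rewrite scale1r. Qed.
Fact linhom_scaleDr : right_distributive linhom_scale +%R.
Proof. by move=> a f g; apply: linhom_ext => x /=; rewrite scalerDr. Qed.
Fact linhom_scaleDl f : {morph linhom_scale^~ f : a b / a + b}.
Proof. by move=> a b; apply: linhom_ext => x /=; rewrite scalerDl. Qed.

HB.instance Definition _ := GRing.Nmodule_isLSemiModule.Build (nnreal R) H
  linhom_scaleA linhom_scale0 linhom_scale1 linhom_scaleDr linhom_scaleDl.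

Lemma lfun0 x : (0 : H) x = 0. Proof. by []. Qed.
Lemma lfunD f g x : (f + g) x = f x + g x. Proof. by []. Qed.
Lemma lfunZ (a : nnreal R) f x : (a *: f) x = a *: f x. Proof. by []. Qed.

Fact linhom_conerI (f f1 f2 : H) : f1 + f = f2 + f -> f1 = f2.
Proof.
move=> /(congr1 (@lfun _ _ _ _)) h; apply: linhom_ext => x.
by have /(congr1 (@^~ x)) /= := h; exact: conerI.
Qed.

Fact linhom_pos (f1 f2 : H) : f1 + f2 = 0 -> f1 = 0.
Proof.
move=> /(congr1 (@lfun _ _ _ _)) h; apply: linhom_ext => x.
by have /(congr1 (@^~ x)) /= := h; exact: cone_pos.
Qed.

HB.instance Definition _ := isPrecone.Build R H linhom_conerI linhom_pos.

Lemma linhom_leP f g : cone_le f g <-> forall x, cone_le (f x) (g x).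
Proof.
split=> [[h ->] x|fg]; first by exists (h x).
have [h hE] := choice fg.
by exists (bhom_lin (bhom_sub (lfun_bhom f) (lfun_bhom g) hE)); exact: linhom_ext.
Qed.

Definition linhom_norm f : R := fine (opnorm f).

Lemma lfun_lin f : cone_linear f. Proof. by have [] := lfun_bhom f. Qed.

Lemma lfun_bound f : cbounded f (linhom_norm f).
Proof. by have [fl _ [K fK] _ _] := lfun_bhom f; exact: (opnorm_bound fl fK). Qed.

Lemma linhom_norm_le f (K : R) : cbounded f K -> linhom_norm f <= K.
Proof. by move=> fK; exact: (fine_opnorm_le (lfun_lin f) fK). Qed.

Fact linhom_normZ (a : nnreal R) f :
  linhom_norm (a *: f) = nnval a * linhom_norm f.
Proof.
apply: le_anti; apply/andP; split.
  apply: linhom_norm_le; split.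
    by rewrite mulr_ge0 ?nnval_ge0//; exact: (lfun_bound f).1.
  move=> x; rewrite lfunZ cnormZ -mulrA ler_wpM2l ?nnval_ge0//.
  exact: (lfun_bound f).2.
have [a0|a0] : 0 = nnval a \/ 0 < nnval a.
    by apply/predU1P; rewrite -le_eqVlt nnval_ge0.
  by rewrite -a0 mul0r; exact: (lfun_bound _).1.
rewrite -ler_pdivlMl//; apply: linhom_norm_le; split.
  by rewrite mulr_ge0 ?invr_ge0 ?nnval_ge0//; exact: (lfun_bound _).1.
move=> x; rewrite -mulrA ler_pdivlMl// -cnormZ; exact: (lfun_bound (a *: f)).2.
Qed.

Fact linhom_norm_eq0 f : linhom_norm f = 0 -> f = 0.
Proof.
move=> f0; apply: linhom_ext => x; apply: cnorm_eq0; apply: le_anti.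
by rewrite cnorm_ge0 andbT; have := (lfun_bound f).2 x; rewrite f0 mul0r.
Qed.

Fact linhom_normD f g : linhom_norm (f + g) <= linhom_norm f + linhom_norm g.
Proof.
have [[f0 fb] [g0 gb]] := (lfun_bound f, lfun_bound g).
apply: linhom_norm_le; split=> [|x]; first exact: addr_ge0.
by apply: le_trans (cnormD _ _) _; rewrite mulrDl lerD.
Qed.

Fact linhom_norm_leD f g : linhom_norm f <= linhom_norm (f + g).
Proof.
apply: linhom_norm_le; split=> [|x]; first exact: (lfun_bound _).1.
by apply: le_trans ((lfun_bound (f + g)).2 x); exact: cnorm_leD.
Qed.

Lemma linhom_lub_pt (u : nat -> H) (K : R) : cone_incr u ->
  (forall n, linhom_norm (u n) <= K) ->
  exists f, [/\ forall x, cone_lub (fun n => u n x) (f x), cone_lub u f &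
                linhom_norm f <= K].
Proof.
move=> iu uK.
have uKb n : cbounded (u n) K.
  have [u0 ub] := lfun_bound (u n); split=> [|x]; first exact: le_trans (uK n).
  by apply: le_trans (ub x) _; rewrite ler_wpM2r// cnorm_ge0.
have ui x : cone_incr (fun n => u n x) by move=> n; have /linhom_leP := iu n.
have /choice[f uf] : forall x, exists y, cone_lub (fun n => u n x) y.
  move=> x; have [|y uy _] := cone_lub_ex (M := K * cnorm x) (ui x).
    by move=> n; exact: (uKb n).2.
  by exists y.
have [fb fK] := bhom_lub (fun n => lfun_bhom (u n)) ui uKb uf.
exists (bhom_lin fb); split=> //; last exact: linhom_norm_le.
split=> [n|g hg]; apply/linhom_leP => x /=; first exact: (uf x).1.
by apply: (uf x).2 => n; have /linhom_leP := hg n.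
Qed.

Fact linhom_complete (u : nat -> H) : cone_incr u ->
  (forall n, linhom_norm (u n) <= 1) ->
  exists2 f, cone_lub u f & linhom_norm f <= 1.
Proof. by move=> iu u1; have [f [_ uf f1]] := linhom_lub_pt iu u1; exists f. Qed.

HB.instance Definition _ := isCone.Build R H linhom_normZ linhom_norm_eq0
  linhom_normD linhom_norm_leD linhom_complete.

Lemma linhom_lub_at (u : nat -> H) (K : R) f : cone_incr u ->
  (forall n, cnorm (u n) <= K) -> cone_lub u f ->
  forall x, cone_lub (fun n => u n x) (f x).
Proof.
move=> iu uK uf; have [g [ug ulg _]] := linhom_lub_pt iu uK.
by rewrite (cone_lub_uniq uf ulg).
Qed.

(* The paths are taken in the unit ball, otherwise the tests would not map the
   unit ball of [H] into [0, 1], as required by [test_meas]; all the paths are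
   rescalings of these, so that the same maps are paths in [H]. *)
Definition linhom_test X : set (Ar X -> H -> nnreal R) :=
  [set t | exists (g : Ar X -> C) (m : Ar X -> D -> nnreal R),
     [/\ is_path g, forall r, cnorm (g r) <= 1, test D X m &
         t = fun r f => m r (f (g r))]].
Arguments linhom_test : clear implicits.

Fact linhom_test_dual X t : linhom_test X t -> forall r, dual_cone (t r).
Proof.
move=> [g [m [gp g1 tm ->]]] r; have [ml mc] := test_dual _ _ tm r.
have tl : cone_linear (fun f : H => m r (f (g r))).
  by split=> [a f|f f']; rewrite ?lfunZ ?lfunD ?ml.1 ?ml.2.
split=> //; split=> [f f'|u M f iu uM uf]; first exact: (cone_lin_le tl).
apply: (mc.2 (fun n => u n (g r)) (M * cnorm (g r)) (f (g r))).
- by move=> n; have /linhom_leP/(_ (g r)) := iu n.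
- move=> n; apply: le_trans ((lfun_bound _).2 _) _.
  by rewrite ler_wpM2r ?cnorm_ge0//; exact: uM.
- exact: (linhom_lub_at iu uM uf).
Qed.

Lemma linhom_test_le X t r f : linhom_test X t -> nnval (t r f) <= cnorm f.
Proof.
move=> [g [m [gp g1 tm ->]]]; apply: le_trans (test_le _ _ tm) _.
apply: le_trans ((lfun_bound f).2 _) _.
by apply: ler_piMr => //; exact: (lfun_bound f).1.
Qed.

Fact linhom_test_meas X t : linhom_test X t -> forall f, cnorm f <= 1 ->
  measurable_fun setT (fun r => nnval (t r f)) /\
  (forall r, nnval (t r f) <= 1).
Proof.
move=> tt f f1; split; last by move=> r; apply: le_trans (linhom_test_le _ _ tt) f1.
move: tt => [g [m [gp g1 tm ->]]]; have [_ _ _ fp _] := lfun_bhom f.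
by apply: (path_diag (fp _ _ gp) tm).
Qed.

Fact linhom_test_comp X Y (phi : Ar Y -> Ar X) : measurable_fun setT phi ->
  forall t, linhom_test X t -> linhom_test Y (fun s f => t (phi s) f).
Proof.
move=> mphi t [g [m [gp g1 tm ->]]].
exists (g \o phi), (fun s x => m (phi s) x); split=> //.
- exact: path_comp.
- by move=> r /=.
- exact: test_comp.
Qed.

Lemma linhom_test_cst m (x : C) : test D (ar_one Ar) m -> cnorm x <= 1 ->
  linhom_test (ar_one Ar) (fun r f => m r (f x)).
Proof. by move=> tm x1; exists (fun=> x), m; split=> //; exact: path_cst. Qed.

Lemma cone_normalize (x : C) : cnorm x != 0 ->
  exists (a : nnreal R) y, [/\ 0 < nnval a, x = a *: y, cnorm y <= 1 & nnval a = cnorm x].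
Proof.
move=> x0; have x1 : 0 < cnorm x by rewrite lt_def x0 cnorm_ge0.
exists (nn (ltW x1)), (nninv (nn (ltW x1)) *: x); split=> //.
- by rewrite cone_scaleVK.
- by rewrite cnormZ /= mulVf.
Qed.

Fact linhom_test_sep f g :
  (forall t, linhom_test (ar_one Ar) t -> t (ar_pt Ar) f = t (ar_pt Ar) g) -> f = g.
Proof.
move=> h; apply: linhom_ext => x.
have [x0|/cone_normalize[a [y [_ -> y1 _]]]] := eqVneq (cnorm x) 0.
  by rewrite (cnorm_eq0 _ x0) !cone_lin0//; exact: lfun_lin.
rewrite (lfun_lin f).1 (lfun_lin g).1; congr (_ *: _).
by apply: test_sep => m tm; exact: (h _ (linhom_test_cst tm y1)).
Qed.

Fact linhom_test_norm f :
  cnorm f = sup [set nnval (t (ar_pt Ar) f) / fine (opnorm (t (ar_pt Ar)))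
                | t in [set t | linhom_test (ar_one Ar) t /\
                                exists g, t (ar_pt Ar) g <> 0]].
Proof.
set A := [set _ | _ in _].
have tb t : linhom_test (ar_one Ar) t ->
    cbounded (t (ar_pt Ar)) (fine (opnorm (t (ar_pt Ar)))).
  move=> tt; apply: (@opnorm_bound _ _ _ _ 1).
    exact: (linhom_test_dual tt _).1.
  by split=> // g; rewrite mul1r; exact: linhom_test_le.
have tpos t : linhom_test (ar_one Ar) t -> (exists g, t (ar_pt Ar) g <> 0) ->
    0 < fine (opnorm (t (ar_pt Ar))).
  move=> tt [g tg]; have [o0 ob] := tb t tt; rewrite lt_def o0 andbT.
  apply/eqP => t0; apply: tg; apply: nnval_inj; apply: le_anti.
  by rewrite nnval_ge0 andbT nnval0; have := ob g; rewrite t0 mul0r.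
have ubA : ubound A (cnorm f).
  move=> _ [t [tt tn] <-]; rewrite ler_pdivrMr; last exact: tpos.
  by rewrite mulrC; exact: (tb t tt).2.
have S0 : 0 <= sup A.
  have [->|/set0P[z Az]] := eqVneq A set0; first by rewrite sup0.
  apply: le_trans (_ : z <= _); last by apply: ub_le_sup => //; exists (cnorm f).
  by case: Az => t _ <-; rewrite divr_ge0 ?nnval_ge0// fine_opnorm_ge0.
apply: le_anti; apply/andP; split; last first.
  have [->|/set0P A0] := eqVneq A set0; first by rewrite sup0 cnorm_ge0.
  exact: ge_sup.
apply: linhom_norm_le; split=> // x.
have [x0|/cone_normalize[a [y [a0 xE y1 aE]]]] := eqVneq (cnorm x) 0.
  by rewrite (cnorm_eq0 _ x0) cone_lin0 ?cnorm0 ?mulr0//; exact: lfun_lin.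
rewrite -aE xE (lfun_lin f).1 cnormZ mulrC ler_wpM2r ?nnval_ge0//.
apply: cnorm_le_test => // m tm.
pose t r (g : H) := m r (g y).
have tt : linhom_test (ar_one Ar) t by exact: linhom_test_cst.
have tm_le : fine (opnorm (t (ar_pt Ar))) <= fine (opnorm (m (ar_pt Ar))).
  apply: fine_opnorm_le; first exact: (linhom_test_dual tt _).1.
  split; first exact: fine_opnorm_ge0.
  move=> g; apply: le_trans (test_opnorm _ _ tm) _.
  rewrite ler_wpM2l ?fine_opnorm_ge0//; apply: le_trans ((lfun_bound g).2 _) _.
  by apply: ler_piMr => //; exact: (lfun_bound g).1.
have [tf0|/eqP tf0] := eqVneq (t (ar_pt Ar) f) 0.
  by rewrite -/(t _ _) tf0 nnval0 mulr_ge0// fine_opnorm_ge0.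
have t0 := tpos t tt (ex_intro _ f tf0).
apply: le_trans (ler_wpM2r S0 tm_le).
rewrite -ler_pdivrMl// mulrC; apply: ub_le_sup; first by exists (cnorm f).
by exists t => //; split=> //; exists f.
Qed.

HB.instance Definition _ := hasTests.Build R Ar H linhom_test_dual
  linhom_test_meas linhom_test_comp linhom_test_sep linhom_test_norm.

Lemma linhom_path_joint X (e : Ar X -> H) Y (g : Ar Y -> C) Z m :
  is_path e -> is_path g -> test D Z m ->
  measurable_fun setT
    (fun p : (Ar Z * Ar Y) * Ar X => nnval (m p.1.1 (e p.2 (g p.1.2)))).
Proof.
move=> [_ em] gp tm.
have [M M0 gM] : exists2 M : R, 0 < M & forall r, cnorm (g r) <= M.
  have [[M gM] _] := gp; exists (M + 1).
    by rewrite ltr_wpDl//; apply: le_trans (gM point); exact: cnorm_ge0.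
  by move=> r; apply: le_trans (gM r) _; rewrite lerDl.
pose a := nn (ltW M0); pose W := ar_prod Z Y.
pose t := fun (w : Ar W) (f : H) =>
  m (ar_unpair w).1 (f (nninv a *: g (ar_unpair w).2)).
have m1 : measurable_fun setT (fun w : Ar W => (ar_unpair w).1).
  by apply: measurableT_comp (@ar_unpair_mfun _ _ _); exact: measurable_fst.
have m2 : measurable_fun setT (fun w : Ar W => (ar_unpair w).2).
  by apply: measurableT_comp (@ar_unpair_mfun _ _ _); exact: measurable_snd.
have tt : test H W t.
  exists (fun w => nninv a *: g (ar_unpair w).2), (fun w => m (ar_unpair w).1).
  split=> //.
  - by apply: pathZ; exact: (path_comp m2 gp).
  - by move=> r; rewrite cnormZ /= ler_pdivrMl// mulr1.
  - exact: (test_comp _ _ _ m1).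
have mt := em W t tt.
rewrite (_ : (fun p => _) = (fun p => M *
   nnval (t (ar_pair p.1) (e p.2)))); last first.
  rewrite funeqE => p; rewrite /t ar_pairK (lfun_lin _).1.
  by rewrite (test_dual _ _ tm _).1.1 nnvalZ /= mulrA mulfV ?gt_eqF// mul1r.
apply: measurable_funM; first exact: measurable_cst.
apply: (measurableT_comp mt
  (g := fun p : (Ar Z * Ar Y) * Ar X => (ar_pair p.1, p.2))).
apply: measurable_fun_pair; last exact: measurable_snd.
by apply: measurableT_comp (@ar_pair_mfun _ _ _) _; exact: measurable_fst.
Qed.

Lemma linhom_path_at X (e : Ar X -> H) x : is_path e -> is_path (fun r => e r x).
Proof.
move=> ep; have [[M eM] _] := ep; split=> [|Z m tm].
  exists (M * cnorm x) => r; apply: le_trans ((lfun_bound _).2 _) _.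
  by rewrite ler_wpM2r ?cnorm_ge0//; exact: eM.
apply: (measurableT_comp (linhom_path_joint ep (path_cst (ar_one Ar) x) tm)
     (g := fun q : Ar Z * Ar X => ((q.1, ar_pt Ar), q.2))).
apply: measurable_fun_pair; last exact: measurable_snd.
by apply: measurable_fun_pair; [exact: measurable_fst|exact: measurable_cst].
Qed.

Lemma linhom_int_at X (e : Ar X -> H) (mu : {finite_measure set (Ar X) -> \bar R}) f :
  (forall x, is_integral (fun r => e r x) mu (f x)) -> is_integral e mu f.
Proof. by move=> ef t [g [m [gp g1 tm ->]]]; exact: ef. Qed.

Lemma linhom_integral_pt X (e : Ar X -> H)
    (mu : {finite_measure set (Ar X) -> \bar R}) : is_path e ->
  exists f, (forall x, is_integral (fun r => e r x) mu (f x)) /\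
            is_integral e mu f.
Proof.
move=> ep; have [[M eM] _] := ep.
have /choice[f ef] : forall x, exists y, is_integral (fun r => e r x) mu y.
  by move=> x; apply: integral_ex; exact: linhom_path_at.
have fb : bhom f.
  apply: (bhom_int (K := M) (fun r => lfun_bhom (e r)) _ _ ef).
    move=> r; split=> [|x]; first by apply: le_trans (eM r); exact: cnorm_ge0.
    by apply: le_trans ((lfun_bound _).2 _) _; rewrite ler_wpM2r ?cnorm_ge0//; exact: eM.
  by move=> Y g gp Z m tm; exact: (linhom_path_joint ep gp tm).
by exists (bhom_lin fb); split=> //; exact: linhom_int_at.
Qed.

Fact linhom_integral_ex X (e : Ar X -> H)
  (mu : {finite_measure set (Ar X) -> \bar R}) :
  is_path e -> exists f, is_integral e mu f.
Proof. by move=> /(linhom_integral_pt mu)[f [_ ef]]; exists f. Qed.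

HB.instance Definition _ := isIntegrable.Build R Ar H linhom_integral_ex.

End LinHom.

Section LinHomPaths.
Context (R : realType) (Ar : arity_cat) (C D : iconeType R Ar).

Lemma linhom_path_pair (X Y : ar_ob Ar) (e : Ar X -> linhom C D) (g : Ar Y -> C) :
  is_path e -> is_path g ->
  is_path (fun w : Ar (ar_prod Y X) => e (ar_unpair w).2 (g (ar_unpair w).1)).
Proof.
move=> ep gp; have [[[M eM] _] [[N gN] _]] := (ep, gp).
split=> [|Z m tm].
  exists (M * N) => w; apply: le_trans ((lfun_bound _).2 _) _.
  by apply: ler_pM; [exact: (lfun_bound _).1|exact: cnorm_ge0|exact: eM|exact: gN].
apply: (measurableT_comp (linhom_path_joint ep gp tm)
  (g := fun q : Ar Z * Ar (ar_prod Y X) =>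
          ((q.1, (ar_unpair q.2).1), (ar_unpair q.2).2))).
have mu2 : measurable_fun setT (fun q : Ar Z * Ar (ar_prod Y X) => ar_unpair q.2).
  by apply: measurableT_comp (@ar_unpair_mfun _ _ _) _; exact: measurable_snd.
apply: measurable_fun_pair.
  apply: measurable_fun_pair; first exact: measurable_fst.
  by apply: measurableT_comp _ mu2; exact: measurable_fst.
by apply: measurableT_comp _ mu2; exact: measurable_snd.
Qed.

Lemma linhom_integralP (X : ar_ob Ar) (e : Ar X -> linhom C D)
    (mu : {finite_measure set (Ar X) -> \bar R}) (f : linhom C D) :
  is_path e ->
  is_integral e mu f <-> (forall x, is_integral (fun r => e r x) mu (f x)).
Proof.
move=> ep; split; last exact: linhom_int_at.
have [g [ge gi]] := linhom_integral_pt mu ep.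
by move=> fe; rewrite (cint_uniq fe gi).
Qed.

End LinHomPaths.

Record imor (R : realType) (Ar : arity_cat) (C D : iconeType R Ar) : Type :=
  IMor { imap :> C -> D; imapP : is_icone_mor imap }.

Section Category.
Context (R : realType) (Ar : arity_cat).
Implicit Types B C D : iconeType R Ar.

Lemma imor_ext C D (f g : imor C D) : (forall x, f x = g x) -> f = g.
Proof.
case: f g => [f fP] [g gP] /= /funext fg; case: _ / fg gP => gP.
by congr IMor; exact: Prop_irrelevance.
Qed.

Lemma icone_morP C D (f : C -> D) : is_icone_mor f <-> bhom f /\ cbounded f 1.
Proof.
split=> [[fl fc f1 fp fi]|[[fl fc _ fp fi] f1]].
  have fb : cbounded f 1 by exact/(opnorm_le fl).
  by split=> //; split=> //; exists 1.
by split=> //; exact/opnorm_le.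
Qed.

Lemma bhom_comp B C D (f : B -> C) (g : C -> D) :
  bhom f -> bhom g -> bhom (fun x => g (f x)).
Proof.
move=> [fl fc [K [K0 fK]] fp fi] [gl gc [L [L0 gL]] gp gi]; split.
- by split=> [a x|x y]; rewrite ?fl.1 ?gl.1 ?fl.2 ?gl.2.
- split=> [x y xy|u M x iu uM ux]; first exact/gc.1/fc.1.
  apply: (gc.2 _ (K * M)); first exact: cone_lin_incr.
    by move=> n; apply: le_trans (fK _) _; exact: ler_wpM2l.
  exact: (fc.2 _ M).
- exists (L * K); split=> [|x]; first exact: mulr_ge0.
  by apply: le_trans (gL _) _; rewrite -mulrA ler_wpM2l.
- by move=> X p pp; exact/(gp _ (fun r => f (p r)))/fp.
- move=> X p mu x pp px.
  by apply: (gi _ (fun r => f (p r))); [exact: fp|exact: fi].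
Qed.

Lemma imor_bhom C D (f : imor C D) : bhom f.
Proof. by have [] := (icone_morP f).1 (imapP f). Qed.

Lemma imor_le C D (f : imor C D) x : cnorm (f x) <= cnorm x.
Proof. by have [_ [_ /(_ x)]] := (icone_morP f).1 (imapP f); rewrite mul1r. Qed.

Fact imor_id_proof C : is_icone_mor (fun x : C => x).
Proof.
apply/icone_morP; split; last by split=> // x; rewrite mul1r.
by split=> //; exists 1; split=> // x; rewrite mul1r.
Qed.
Definition imor_id C : imor C C := IMor (imor_id_proof C).

Fact imor_comp_proof B C D (g : imor C D) (f : imor B C) :
  is_icone_mor (fun x => g (f x)).
Proof.
apply/icone_morP; split; first exact: bhom_comp (imor_bhom f) (imor_bhom g).
by split=> // x; rewrite mul1r; apply: le_trans (imor_le _ _) (imor_le _ _).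
Qed.
Definition imor_comp B C D (g : imor C D) (f : imor B C) : imor B D :=
  IMor (imor_comp_proof g f).

Definition is_icone_iso C D (f : imor C D) : Prop :=
  exists g : imor D C, imor_comp g f = imor_id C /\ imor_comp f g = imor_id D.

Section LinHomFunctor.
Context (C C' D D' : iconeType R Ar) (h : imor C' C) (k : imor D D').

Fact linhom_comp_proof (f : linhom C D) : bhom (fun x => k (f (h x))).
Proof. exact: bhom_comp (bhom_comp (imor_bhom h) (lfun_bhom f)) (imor_bhom k). Qed.

Definition linhom_comp (f : linhom C D) : linhom C' D' :=
  bhom_lin (linhom_comp_proof f).

Fact linhom_map_proof : is_icone_mor linhom_comp.
Proof.
have [kl kc [K [K0 kK]] kp ki] := imor_bhom k.
have [hl hc [L [L0 hL]] hp hi] := imor_bhom h.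
apply/icone_morP.
have lin : cone_linear linhom_comp.
  by split=> [a f|f g]; apply: linhom_ext => x; rewrite /= ?kl.1 ?kl.2.
have bnd : cbounded linhom_comp 1.
  split=> // f; rewrite mul1r; apply: linhom_norm_le; split.
    exact: (lfun_bound f).1.
  move=> x; apply: le_trans (imor_le _ _) _; apply: le_trans ((lfun_bound f).2 _) _.
  by apply: ler_wpM2l; [exact: (lfun_bound f).1|exact: imor_le].
split=> //; split=> //; last 3 first.
- by exists 1.
- move=> X e ep; split=> [|Y t [g [m [gp g1 tm ->]]]].
    have [[M eM] _] := ep; exists M => r; apply: le_trans (eM r).
    by rewrite -[leRHS]mul1r; exact: bnd.2.
  have pp := kp _ _ (linhom_path_pair ep (hp _ _ gp)).
  have /= mm := (pp.2 _ _ tm).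
  rewrite [X in measurable_fun _ X](_ : _ =
    (fun q : Ar Y * Ar (ar_prod Y X) => nnval (m q.1 (k (e (ar_unpair q.2).2
       (h (g (ar_unpair q.2).1)))))) \o (fun p => (p.1, ar_pair p))); last first.
    by rewrite funeqE => p /=; rewrite ar_pairK.
  apply: measurableT_comp mm _.
  by apply: measurable_fun_pair; [exact: measurable_fst|exact: ar_pair_mfun].
- move=> X e mu f ep ef; apply: linhom_int_at => x /=.
  apply: ki; first exact: linhom_path_at.
  by apply: (linhom_integralP mu f ep).1.
split=> [f g|u M f iu uM uf]; first exact: cone_lin_le.
have icu := cone_lin_incr lin iu.
have [|w [wpt wl _]] := linhom_lub_pt (K := M) icu.
  move=> n; apply: le_trans (uM n).
  by rewrite -[leRHS]mul1r; exact: bnd.2.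
suff <- : w = linhom_comp f by [].
apply: linhom_ext => x; apply: (cone_lub_uniq (wpt x)) => /=.
apply: (kc.2 (fun n => u n (h x)) (M * cnorm (h x))).
- by move=> n; have /linhom_leP/(_ (h x)) := iu n.
- move=> n; apply: le_trans ((lfun_bound _).2 _) _.
  by rewrite ler_wpM2r ?cnorm_ge0//; exact: uM.
- exact: (linhom_lub_at iu uM uf).
Qed.

Definition linhom_map : imor (linhom C D) (linhom C' D') := IMor linhom_map_proof.

End LinHomFunctor.

(* A bifunctor [tens] such that each [tens - C] is left adjoint to
   [linhom C -], with an adjunction bijection natural in all its arguments.
   It is determined up to natural isomorphism. *)
Record tensor := Tensor {
  tens : iconeType R Ar -> iconeType R Ar -> iconeType R Ar;
  tens_map : forall B B' C C', imor B B' -> imor C C' ->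
    imor (tens B C) (tens B' C');
  tens_map_id : forall B C,
    tens_map (imor_id B) (imor_id C) = imor_id (tens B C);
  tens_map_comp : forall B B' B'' C C' C'' (g' : imor B' B'') (g : imor B B')
      (h' : imor C' C'') (h : imor C C'),
    tens_map (imor_comp g' g) (imor_comp h' h) =
    imor_comp (tens_map g' h') (tens_map g h);
  tens_curry : forall B C D, imor (tens B C) D -> imor B (linhom C D);
  tens_curry_bij : forall B C D, bijective (@tens_curry B C D);
  tens_curry_nat : forall B B' C C' D D' (g : imor B' B) (h : imor C' C)
      (k : imor D D') (f : imor (tens B C) D),
    tens_curry (imor_comp k (imor_comp f (tens_map g h))) =
    imor_comp (linhom_map h k) (imor_comp (tens_curry f) g)
}.

Definition tens_elt (T : tensor) B C (x : B) (y : C) : tens T B C :=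
  tens_curry (imor_id (tens T B C)) x y.

End Category.

Arguments tensor R Ar : clear implicits.

(* Main.v *)
(* Rescaling extends the adjunction bijection from the unit balls to a norm
   preserving bijection between the whole cones. Its direct part sends tests of
   B -o (C -o D) back to tests of (B (x) C) -o D, because x (x) y is a path
   whenever x and y are. For the inverse the only difficulty is that it
   preserves paths. The paths of arity X in D form an integrable cone, and a
   path X -> (B -o (C -o D)) is the same thing as an element of
   B -o (C -o Path(X, D)); the adjunction turns it into an element of
   (B (x) C) -o Path(X, D), that is, into a path X -> ((B (x) C) -o D). *)
Require Import Defs.
From HB Require Import structures.
From mathcomp Require Import all_boot all_order all_algebra.
From mathcomp Require Import all_classical all_reals ereal topology normedtype sequences measure measurable_realfun lebesgue_measure lebesgue_integral.

Set Implicit Arguments.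
Unset Strict Implicit.
Unset Printing Implicit Defensive.

Import Order.TTheory GRing.Theory Num.Theory.
Import numFieldNormedType.Exports.

Local Open Scope classical_set_scope.
Local Open Scope ring_scope.

(** * Norms as suprema over families of functionals *)

Section NormTests.
Context (R : realType) (P : coneType R).

(** Every ratio is at most [cnorm x] by definition of the operator norm; conversely the supremum
    itself is an admissible [K] in the last hypothesis. For a proposed family of tests, the norm
    axiom thus reduces to that hypothesis. *)
Lemma cnorm_sup_tests (I : Type) (S : set I) (F : I -> P -> nnreal R) (x : P) :
  (forall i, S i -> cone_linear (F i)) -> (forall i, S i -> cbounded (F i) 1) ->
  (forall K : R, 0 <= K ->
     (forall i, S i -> nnval (F i x) <= fine (opnorm (F i)) * K) -> cnorm x <= K) ->
  cnorm x = sup [set nnval (F i x) / fine (opnorm (F i))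
                | i in [set i | S i /\ exists y, F i y <> 0]].
Proof.
move=> Sl Sb xS; set A := [set _ | _ in _].
have Fb i : S i -> cbounded (F i) (fine (opnorm (F i))).
  by move=> Si; apply: opnorm_bound (Sb _ Si); exact: Sl.
have Fpos i y : S i -> F i y <> 0 -> 0 < fine (opnorm (F i)).
  move=> Si Fy; have [o0 ob] := Fb i Si; rewrite lt_def o0 andbT.
  apply/eqP => F0; apply: Fy; apply: nnval_inj; apply: le_anti.
  by rewrite nnval_ge0 andbT nnval0; have := ob y; rewrite F0 mul0r.
have ubA : ubound A (cnorm x).
  move=> _ [i [Si [y Fy]] <-]; rewrite ler_pdivrMr; last exact: Fpos Fy.
  by rewrite mulrC; exact: (Fb i Si).2.
have A0 : 0 <= sup A.
  have [->|/set0P[z Az]] := eqVneq A set0; first by rewrite sup0.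
  apply: le_trans (_ : z <= _); last by apply: ub_le_sup => //; exists (cnorm x).
  by case: Az => i _ <-; rewrite divr_ge0 ?nnval_ge0// fine_opnorm_ge0.
apply: le_anti; apply/andP; split; last first.
  by have [->|/set0P An] := eqVneq A set0; [rewrite sup0 cnorm_ge0|exact: ge_sup].
(* Here [K] is [sup A]. A functional vanishing at [x] may be zero, hence absent from [A], so this
   case is treated apart. *)
apply: xS => // i Si; have [->|/eqP Fx] := eqVneq (F i x) 0.
  by rewrite nnval0 mulr_ge0// fine_opnorm_ge0.
rewrite -ler_pdivrMl; last exact: Fpos Fx.
rewrite mulrC; apply: ub_le_sup; first by exists (cnorm x).
by exists i => //; split=> //; exists x.
Qed.

End NormTests.

(** * Linear maps that pull tests back to tests *)

Section TestPullback.
Context (R : realType) (Ar : arity_cat).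

(* No continuity hypothesis: lubs are computed through the tests. *)
Lemma bhom_test_pullback (C D : iconeType R Ar) (f : C -> D) (K : R) :
  cone_linear f -> cbounded f K ->
  (forall X m, test D X m -> test C X (fun r x => m r (f x))) -> bhom f.
Proof.
move=> fl fK ft; split=> //.
- split=> [x y|u M x iu uM ux]; first exact: cone_lin_le.
  have ifu := cone_lin_incr fl iu.
  have fuM n : cnorm (f (u n)) <= K * M.
    by apply: le_trans (fK.2 _) _; apply: ler_wpM2l => //; exact: fK.1.
  (* Completeness gives a lub of the images; every test takes the same value on it as on [f x],
     because the pulled-back test is continuous. *)
  have [y uy _] := cone_lub_ex ifu fuM.
  suff <- : y = f x by [].
  apply: (test_lub_eq ifu uy); first by exists (K * M).
  by move=> m tm; exact: (test_lub_cvg (ft _ _ tm) iu uM ux).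
- by exists K.
- move=> X g [[M gM] gm]; split=> [|Y m tm]; last exact: gm (ft _ _ tm).
  exists (K * M) => r; apply: le_trans (fK.2 _) _.
  by apply: ler_wpM2l => //; exact: fK.1.
- by move=> X g mu x _ gx m tm; exact: gx (ft _ _ tm).
Qed.

End TestPullback.

(** * The integrable cone of paths of arity [X] in [D] *)

Record mpath (R : realType) (Ar : arity_cat) (X : ar_ob Ar) (D : iconeType R Ar) :
  Type := MPath { pfun :> Ar X -> D; pfunP : is_path pfun }.

Section PathCone.
Context (R : realType) (Ar : arity_cat) (X : ar_ob Ar) (D : iconeType R Ar).
Local Notation H := (mpath X D).
Implicit Types p q : H.

Lemma mpath_ext p q : (forall r, p r = q r) -> p = q.
Proof.
case: p q => [p pP] [q qP] /= /funext pq; case: _ / pq qP => qP.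
by congr MPath; exact: Prop_irrelevance.
Qed.

HB.instance Definition _ := gen_eqMixin H.
HB.instance Definition _ := gen_choiceMixin H.

Definition mpath_zero : H := MPath (path_cst X (0 : D)).
Definition mpath_add p q : H := MPath (pathD (pfunP p) (pfunP q)).
Definition mpath_scale (a : nnreal R) p : H := MPath (pathZ a (pfunP p)).

Fact mpath_addA : associative mpath_add.
Proof. by move=> p q s; apply: mpath_ext => r /=; rewrite addrA. Qed.
Fact mpath_addC : commutative mpath_add.
Proof. by move=> p q; apply: mpath_ext => r /=; rewrite addrC. Qed.
Fact mpath_add0 : left_id mpath_zero mpath_add.
Proof. by move=> p; apply: mpath_ext => r /=; rewrite add0r. Qed.

HB.instance Definition _ :=
  GRing.isNmodule.Build H mpath_addA mpath_addC mpath_add0.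

Fact mpath_scaleA (a b : nnreal R) p :
  mpath_scale a (mpath_scale b p) = mpath_scale (a * b) p.
Proof. by apply: mpath_ext => r /=; rewrite scalerA. Qed.
Fact mpath_scale0 p : mpath_scale 0 p = 0.
Proof. by apply: mpath_ext => r /=; rewrite scale0r. Qed.
Fact mpath_scale1 : left_id 1 mpath_scale.
Proof. by move=> p; apply: mpath_ext => r /=; rewrite scale1r. Qed.
Fact mpath_scaleDr : right_distributive mpath_scale +%R.
Proof. by move=> a p q; apply: mpath_ext => r /=; rewrite scalerDr. Qed.
Fact mpath_scaleDl p : {morph mpath_scale^~ p : a b / a + b}.
Proof. by move=> a b; apply: mpath_ext => r /=; rewrite scalerDl. Qed.

HB.instance Definition _ := GRing.Nmodule_isLSemiModule.Build (nnreal R) H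
  mpath_scaleA mpath_scale0 mpath_scale1 mpath_scaleDr mpath_scaleDl.

Lemma pfunD p q r : (p + q) r = p r + q r. Proof. by []. Qed.
Lemma pfunZ (a : nnreal R) p r : (a *: p) r = a *: p r. Proof. by []. Qed.

Fact mpath_conerI (p p1 p2 : H) : p1 + p = p2 + p -> p1 = p2.
Proof.
move=> /(congr1 (@pfun _ _ _ _)) h; apply: mpath_ext => r.
by have /(congr1 (@^~ r)) /= := h; exact: conerI.
Qed.

Fact mpath_pos (p1 p2 : H) : p1 + p2 = 0 -> p1 = 0.
Proof.
move=> /(congr1 (@pfun _ _ _ _)) h; apply: mpath_ext => r.
by have /(congr1 (@^~ r)) /= := h; exact: cone_pos.
Qed.

HB.instance Definition _ := isPrecone.Build R H mpath_conerI mpath_pos.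

(** The pointwise complements form a path because measurability is stable under subtraction
    ([pathBr]). *)
Lemma mpath_leP p q : cone_le p q <-> forall r, cone_le (p r) (q r).
Proof.
split=> [[s ->] r|pq]; first by exists (s r).
have [s sE] := choice pq.
by exists (MPath (pathBr (pfunP p) (pfunP q) sE)); exact: mpath_ext.
Qed.

Lemma mpath_lub_pointwise (u : nat -> H) p :
  (forall r, cone_lub (fun n => u n r) (p r)) -> cone_lub u p.
Proof.
move=> up; split=> [n|q uq]; apply/mpath_leP => r; first exact: (up r).1.
by apply: (up r).2 => n; have /mpath_leP := uq n.
Qed.

Definition mpath_norm p : R := sup (range (fun r => cnorm (p r))).

Lemma pfun_bound p r : cnorm (p r) <= mpath_norm p.
Proof.
apply: ub_le_sup; last by exists r.
by have [[M pM] _] := pfunP p; exists M => _ [s _ <-].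
Qed.

Lemma mpath_norm_le p (K : R) : (forall r, cnorm (p r) <= K) -> mpath_norm p <= K.
Proof.
move=> pK; apply: ge_sup => [|_ [r _ <-]//].
by exists (cnorm (p point)), point.
Qed.

Lemma mpath_norm_ge0 p : 0 <= mpath_norm p.
Proof. exact: le_trans (cnorm_ge0 _) (pfun_bound p point). Qed.

Fact mpath_normZ (a : nnreal R) p : mpath_norm (a *: p) = nnval a * mpath_norm p.
Proof.
apply: le_anti; apply/andP; split.
  by apply: mpath_norm_le => r; rewrite pfunZ cnormZ ler_wpM2l ?nnval_ge0 ?pfun_bound.
have [a0|a0] : 0 = nnval a \/ 0 < nnval a.
    by apply/predU1P; rewrite -le_eqVlt nnval_ge0.
  by rewrite -a0 mul0r mpath_norm_ge0.
rewrite -ler_pdivlMl//; apply: mpath_norm_le => r.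
by rewrite ler_pdivlMl// -cnormZ; exact: (pfun_bound (a *: p)).
Qed.

Fact mpath_norm_eq0 p : mpath_norm p = 0 -> p = 0.
Proof.
move=> p0; apply: mpath_ext => r; apply: cnorm_eq0; apply: le_anti.
by rewrite cnorm_ge0 andbT -p0 pfun_bound.
Qed.

Fact mpath_normD p q : mpath_norm (p + q) <= mpath_norm p + mpath_norm q.
Proof.
apply: mpath_norm_le => r; apply: le_trans (cnormD _ _) _.
by apply: lerD; exact: pfun_bound.
Qed.

Fact mpath_norm_leD p q : mpath_norm p <= mpath_norm (p + q).
Proof.
apply: mpath_norm_le => r; apply: le_trans (pfun_bound (p + q) r).
exact: cnorm_leD.
Qed.

(** Tests are continuous, so each measurability condition on [f] concerns a pointwise limit of
    measurable functions. *)
Lemma path_lub (u : nat -> Ar X -> D) (K : R) (f : Ar X -> D) :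
  (forall n, is_path (u n)) -> (forall r, cone_incr (fun n => u n r)) ->
  (forall n r, cnorm (u n r) <= K) ->
  (forall r, cone_lub (fun n => u n r) (f r)) -> is_path f.
Proof.
move=> up ui uK uf; split=> [|Y m tm].
  by exists K => r; exact: cone_lub_norm (ui r) (uK^~ r) (uf r).
apply: (measurable_fun_cvg (h := fun n (q : Ar Y * Ar X) => nnval (m q.1 (u n q.2)))).
  by move=> n; exact: (up n).2.
by move=> q _; exact: (test_lub_cvg tm (ui q.2) (uK^~ q.2) (uf q.2)).
Qed.

Lemma mpath_lub_pt (u : nat -> H) (K : R) : cone_incr u ->
  (forall n, mpath_norm (u n) <= K) ->
  exists p, [/\ forall r, cone_lub (fun n => u n r) (p r), cone_lub u p &
                mpath_norm p <= K].
Proof.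
move=> iu uK.
have ui r : cone_incr (fun n => u n r) by move=> n; have /mpath_leP := iu n.
have uKr n r : cnorm (u n r) <= K := le_trans (pfun_bound _ _) (uK n).
have /choice[f uf] : forall r, exists y, cone_lub (fun n => u n r) y.
  by move=> r; have [y uy _] := cone_lub_ex (ui r) (uKr^~ r); exists y.
exists (MPath (path_lub (fun n => pfunP (u n)) ui uKr uf)); split=> //.
  exact: mpath_lub_pointwise.
by apply: mpath_norm_le => r; exact: cone_lub_norm (ui r) (uKr^~ r) (uf r).
Qed.

Fact mpath_complete (u : nat -> H) : cone_incr u ->
  (forall n, mpath_norm (u n) <= 1) ->
  exists2 p, cone_lub u p & mpath_norm p <= 1.
Proof. by move=> iu u1; have [p [_ up p1]] := mpath_lub_pt iu u1; exists p. Qed.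

HB.instance Definition _ := isCone.Build R H mpath_normZ mpath_norm_eq0
  mpath_normD mpath_norm_leD mpath_complete.

(** The pointwise lub of a bounded increasing sequence is again a path and a lub, and lubs are
    unique. *)
Lemma mpath_lub_at (u : nat -> H) (K : R) p : cone_incr u ->
  (forall n, cnorm (u n) <= K) -> cone_lub u p ->
  forall r, cone_lub (fun n => u n r) (p r).
Proof.
move=> iu uK up; have [q [uq ulq _]] := mpath_lub_pt iu uK.
by rewrite (cone_lub_uniq up ulq).
Qed.

(* Evaluating along an arbitrary [phi], rather than at fixed points, is what
   makes a path [e] of arity [Y] in this cone jointly measurable in [X] and
   [Y]. *)
Definition mpath_test Y : set (Ar Y -> H -> nnreal R) :=
  [set t | exists (phi : Ar Y -> Ar X) (m : Ar Y -> D -> nnreal R),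
     [/\ measurable_fun setT phi, test D Y m & t = fun s p => m s (p (phi s))]].
Arguments mpath_test : clear implicits.

Fact mpath_test_dual Y t : mpath_test Y t -> forall s, dual_cone (t s).
Proof.
move=> [phi [m [mphi tm ->]]] s; have [ml mc] := test_dual _ _ tm s.
have tl : cone_linear (fun p : H => m s (p (phi s))).
  by split=> [a p|p q]; rewrite ?pfunZ ?pfunD ?ml.1 ?ml.2.
split=> //; split=> [p q|u M p iu uM up]; first exact: (cone_lin_le tl).
apply: (mc.2 (fun n => u n (phi s)) M).
- by move=> n; have /mpath_leP := iu n.
- by move=> n; exact: le_trans (pfun_bound _ _) (uM n).
- exact: (mpath_lub_at iu uM up).
Qed.

Lemma mpath_test_le Y t s p : mpath_test Y t -> nnval (t s p) <= cnorm p.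
Proof.
move=> [phi [m [mphi tm ->]]].
exact: le_trans (test_le _ _ tm) (pfun_bound _ _).
Qed.

Fact mpath_test_meas Y t : mpath_test Y t -> forall p, cnorm p <= 1 ->
  measurable_fun setT (fun s => nnval (t s p)) /\
  (forall s, nnval (t s p) <= 1).
Proof.
move=> tt p p1; split; last by move=> s; apply: le_trans (mpath_test_le _ _ tt) p1.
move: tt => [phi [m [mphi tm ->]]].
exact: (path_meas (pfunP p) tm (@measurable_id _ _ setT) mphi).
Qed.

Fact mpath_test_comp Y Z (psi : Ar Z -> Ar Y) : measurable_fun setT psi ->
  forall t, mpath_test Y t -> mpath_test Z (fun s p => t (psi s) p).
Proof.
move=> mpsi t [phi [m [mphi tm ->]]].
exists (phi \o psi), (fun s x => m (psi s) x); split=> //.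
- exact: measurableT_comp.
- exact: test_comp.
Qed.

Lemma mpath_test_cst Y m (r : Ar X) : test D Y m ->
  mpath_test Y (fun s p => m s (p r)).
Proof. by move=> tm; exists (fun=> r), m. Qed.

Fact mpath_test_sep p q :
  (forall t, mpath_test (ar_one Ar) t -> t (ar_pt Ar) p = t (ar_pt Ar) q) -> p = q.
Proof.
move=> h; apply: mpath_ext => r; apply: test_sep => m tm.
exact: (h _ (mpath_test_cst r tm)).
Qed.

Fact mpath_test_norm p :
  cnorm p = sup [set nnval (t (ar_pt Ar) p) / fine (opnorm (t (ar_pt Ar)))
                | t in [set t | mpath_test (ar_one Ar) t /\
                                exists q, t (ar_pt Ar) q <> 0]].
Proof.
have tb t : mpath_test (ar_one Ar) t -> cbounded (t (ar_pt Ar)) 1.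
  by move=> tt; split=> // q; rewrite mul1r; exact: mpath_test_le.
apply: (cnorm_sup_tests (S := mpath_test (ar_one Ar)) (F := @^~ (ar_pt Ar))) => //.
  by move=> t tt; exact: (mpath_test_dual tt _).1.
move=> K K0 pK; apply: mpath_norm_le => r; apply: cnorm_le_test => // m tm.
have tt := mpath_test_cst r tm.
(* Evaluation at [r] does not increase norms, so [m] composed with it has operator norm at most that
   of [m]. *)
apply: le_trans (pK _ tt) _; apply: ler_wpM2r => //.
apply: fine_opnorm_le; first exact: (mpath_test_dual tt _).1.
split=> [|q]; first exact: fine_opnorm_ge0.
apply: le_trans (test_opnorm _ _ tm) _.
by apply: ler_wpM2l; [exact: fine_opnorm_ge0|exact: pfun_bound].
Qed.

HB.instance Definition _ := hasTests.Build R Ar H mpath_test_dual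
  mpath_test_meas mpath_test_comp mpath_test_sep mpath_test_norm.

(** The test used has the product of [Z] and [X] as arity, with [phi] the second projection and [m]
    pulled back along the first. *)
Lemma mpath_joint Y (e : Ar Y -> H) Z m : is_path e -> test D Z m ->
  measurable_fun setT
    (fun w : (Ar Z * Ar X) * Ar Y => nnval (m w.1.1 (e w.2 w.1.2))).
Proof.
move=> [_ em] tm; pose W := ar_prod Z X.
have m1 : measurable_fun setT (fun w : Ar W => (ar_unpair w).1).
  by apply: measurableT_comp (@ar_unpair_mfun _ _ _); exact: measurable_fst.
have m2 : measurable_fun setT (fun w : Ar W => (ar_unpair w).2).
  by apply: measurableT_comp (@ar_unpair_mfun _ _ _); exact: measurable_snd.
have tt : test H W (fun w p => m (ar_unpair w).1 (p (ar_unpair w).2)).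
  by exists (fun w => (ar_unpair w).2), (fun w => m (ar_unpair w).1); split=> //;
    exact: (test_comp _ _ _ m1).
rewrite (_ : (fun w => _) = (fun v : Ar W * Ar Y =>
    nnval (m (ar_unpair v.1).1 (e v.2 (ar_unpair v.1).2))) \o
    (fun w => (ar_pair w.1, w.2))); last by rewrite funeqE => w /=; rewrite ar_pairK.
apply: measurableT_comp (em _ _ tt) _.
apply: measurable_fun_pair; last exact: measurable_snd.
by apply: measurableT_comp (@ar_pair_mfun _ _ _) _; exact: measurable_fst.
Qed.

(** Integrals are taken pointwise in [X]; Fubini-Tonelli, fed by [mpath_joint], makes the result
    measurable against all tests. *)
Fact mpath_integral_ex Y (e : Ar Y -> H)
  (mu : {finite_measure set (Ar Y) -> \bar R}) :
  is_path e -> exists p, is_integral e mu p.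
Proof.
move=> ep; have [[M eM] em] := ep.
have ept r : is_path (fun y => e y r).
  split; first by exists M => y; exact: le_trans (pfun_bound _ _) (eM y).
  by move=> Z m tm; exact: em (mpath_test_cst r tm).
have M0 : 0 <= M := le_trans (cnorm_ge0 _) (eM point).
have /choice[f ef] : forall r, exists y, is_integral (fun y => e y r) mu y.
  by move=> r; exact: integral_ex.
have fp : is_path f.
  split=> [|Z m tm].
    exists (M * fine (mu setT)) => r; apply: (cint_norm (ept r) M0 _ (ef r)) => y.
    exact: le_trans (pfun_bound _ _) (eM y).
  apply/measurable_EFinP.
  rewrite (_ : _ \o _ = fun q : Ar Z * Ar X =>
     (\int[mu]_y (nnval (m q.1 (e y q.2)))%:E)%E); last first.
    by rewrite funeqE => q /=; exact: (cint_at _ tm (ef _)).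
  apply: (measurable_fun_fubini_tonelli_F
    (fun z : (Ar Z * Ar X) * Ar Y => (nnval (m z.1.1 (e z.2 z.1.2)))%:E)).
    by apply/measurable_EFinP; exact: (mpath_joint ep tm).
  by move=> z; rewrite lee_fin nnval_ge0.
exists (MPath fp) => t [phi [m [_ tm ->]]].
exact: (cint_at (ar_pt Ar) tm (ef (phi (ar_pt Ar)))).
Qed.

HB.instance Definition _ := isIntegrable.Build R Ar H mpath_integral_ex.

Lemma mpath_int_at Y (e : Ar Y -> H) (mu : {finite_measure set (Ar Y) -> \bar R}) p :
  (forall r, is_integral (fun y => e y r) mu (p r)) -> is_integral e mu p.
Proof.
move=> ep t [phi [m [_ tm ->]]].
exact: (cint_at (ar_pt Ar) tm (ep (phi (ar_pt Ar)))).
Qed.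

Lemma mpath_eval_bhom (r : Ar X) : bhom (fun p : H => p r).
Proof.
apply: (@bhom_test_pullback _ _ _ _ _ 1) => //.
- by split=> // p; rewrite mul1r; exact: pfun_bound.
- by move=> Y m tm; exact: (mpath_test_cst r tm).
Qed.

End PathCone.

(** * Exchanging paths with linear maps *)

Section PathSwap.
Context (R : realType) (Ar : arity_cat) (X : ar_ob Ar) (C D : iconeType R Ar).

Lemma path_linhom_swap_bhom (e : Ar X -> linhom C D) (ep : is_path e) :
  bhom (fun x => MPath (linhom_path_at x ep)).
Proof.
have [[M eM] _] := ep.
have M0 : 0 <= M := le_trans (cnorm_ge0 _) (eM point).
have eb r x : cnorm (e r x) <= M * cnorm x.
  apply: le_trans ((lfun_bound _).2 _) _.
  by rewrite ler_wpM2r ?cnorm_ge0//; exact: eM.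
have el : cone_linear (fun x => MPath (linhom_path_at x ep)).
  split=> [a x|x y]; apply: mpath_ext => r /=; first exact: (lfun_lin _).1.
  exact: (lfun_lin _).2.
have eB : cbounded (fun x => MPath (linhom_path_at x ep)) M.
  by split=> // x; apply: mpath_norm_le => r; exact: eb.
split=> //.
- split=> [x y|u N x iu uN ux]; first exact: (cone_lin_le el).
  apply: mpath_lub_pointwise => r /=; have [_ ec _ _ _] := lfun_bhom (e r).
  exact: (ec.2 _ N).
- by exists M.
- move=> Y g gp; split=> [|Z t [phi [m [mphi tm ->]]]].
    have [[N gN] _] := gp; exists (M * N) => s.
    by apply: le_trans (eB.2 _) _; exact: ler_wpM2l.
  (* The parameter [z] of the test also selects the point [phi z] of [X], so joint measurability is
     used along [((z, y), phi z)]. *)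
  apply: (measurableT_comp (linhom_path_joint ep gp tm)
    (g := fun q : Ar Z * Ar Y => ((q.1, q.2), phi q.1))).
  apply: measurable_fun_pair.
    by apply: measurable_fun_pair; [exact: measurable_fst|exact: measurable_snd].
  by apply: measurableT_comp mphi _; exact: measurable_fst.
- move=> Y g mu x gp gx; apply: mpath_int_at => r /=.
  by have [_ _ _ _ ei] := lfun_bhom (e r); exact: ei.
Qed.

Definition path_linhom_swap (p : mpath X (linhom C D)) : linhom C (mpath X D) :=
  bhom_lin (path_linhom_swap_bhom (pfunP p)).

(** A test of the target reads [m s (f (g s) (phi s))]; it pulls back to the test of paths in
    [linhom C D] given by the same [phi] and by the test of [linhom C D] built from [g] and [m]. *)
Lemma bhom_path_linhom_swap : bhom path_linhom_swap.
Proof.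
apply: (@bhom_test_pullback _ _ _ _ _ 1).
- by split=> [a p|p q]; apply: linhom_ext => x; apply: mpath_ext.
- split=> // p; rewrite mul1r; apply: linhom_norm_le.
  split=> [|x]; first exact: cnorm_ge0.
  apply: mpath_norm_le => r /=; apply: le_trans ((lfun_bound _).2 _) _.
  by rewrite ler_wpM2r ?cnorm_ge0//; exact: pfun_bound.
move=> Y _ [g [_ [gp g1 [phi [m [mphi tm ->]]] ->]]].
by exists phi, (fun s (f : linhom C D) => m s (f (g s))); split=> //; exists g, m.
Qed.

(** The transposition opposite to [path_linhom_swap]: it reads a linear map valued in paths as a
    path of linear maps. *)
Definition linhom_path_eval (f : linhom C (mpath X D)) (r : Ar X) : linhom C D :=
  bhom_lin (bhom_comp (lfun_bhom f) (mpath_eval_bhom D r)).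

Lemma linhom_path_eval_path f : is_path (linhom_path_eval f).
Proof.
split=> [|Y _ [g [m [gp g1 tm ->]]]].
  exists (cnorm f) => r; apply: linhom_norm_le; split=> [|x /=].
    exact: cnorm_ge0.
  exact: le_trans (pfun_bound _ _) ((lfun_bound f).2 x).
have [_ _ _ fp _] := lfun_bhom f.
(* [f] sends [g] to a path in [mpath X D], which is jointly measurable; the parameter of the test
   and that of [g] are then identified. *)
apply: (measurableT_comp (mpath_joint (fp _ _ gp) tm)
  (g := fun q : Ar Y * Ar X => ((q.1, q.2), q.1))).
apply: measurable_fun_pair; last exact: measurable_fst.
by apply: measurable_fun_pair; [exact: measurable_fst|exact: measurable_snd].
Qed.

End PathSwap.

(** * The currying bijection between whole cones *)

Lemma bhom_ball_imor (R : realType) (Ar : arity_cat) (C D : iconeType R Ar)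
    (f : linhom C D) : cnorm f <= 1 -> is_icone_mor f.
Proof.
move=> f1; apply/icone_morP; split; first exact: lfun_bhom.
split=> // x; apply: le_trans ((lfun_bound f).2 x) _.
by rewrite ler_wpM2r ?cnorm_ge0.
Qed.

Section Curry.
Context (R : realType) (Ar : arity_cat) (T : tensor R Ar).
Implicit Types B C D : iconeType R Ar.

(** Naturality in the last argument, applied to [f] composed with the identity of [tens T B C], as
    in the Yoneda lemma. *)
Lemma tens_curryE B C D (f : imor (tens T B C) D) x y :
  tens_curry f x y = f (tens_elt T x y).
Proof.
have := tens_curry_nat (imor_id B) (imor_id C) f (imor_id (tens T B C)).
rewrite tens_map_id.
rewrite [imor_comp (imor_id _) _](_ : _ = imor_id (tens T B C)); last exact: imor_ext.
rewrite [imor_comp f _](_ : _ = f); last exact: imor_ext.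
by move=> ->.
Qed.

Lemma tens_elt_norm B C (x : B) (y : C) :
  cnorm (tens_elt T x y) <= cnorm x * cnorm y.
Proof.
apply: le_trans ((lfun_bound _).2 _) _.
by rewrite ler_wpM2r ?cnorm_ge0//; exact: imor_le.
Qed.

(** The curried identity turns [g] into a path of linear maps, which pairs with [h] into a path over
    the product arity; this path is restricted to the diagonal. *)
Lemma tens_elt_path B C X (g : Ar X -> B) (h : Ar X -> C) :
  is_path g -> is_path h -> is_path (fun r => tens_elt T (g r) (h r)).
Proof.
move=> gp hp; have [_ _ _ tp _] := imor_bhom (tens_curry (imor_id (tens T B C))).
have pp := linhom_path_pair (tp _ _ gp) hp.
rewrite (_ : (fun r => _) = (fun w => tens_curry (imor_id (tens T B C))
   (g (ar_unpair w).2) (h (ar_unpair w).1)) \o (fun r => ar_pair (r, r))).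
  apply: path_comp pp; apply: measurableT_comp (@ar_pair_mfun _ _ _) _.
  exact: measurable_fun_pair.
by rewrite funeqE => r /=; rewrite ar_pairK.
Qed.

Context (B C D : iconeType R Ar).
Local Notation BCD := (linhom (tens T B C) D).

Lemma bhom_tens_elt (x : B) (f : BCD) : bhom (fun y : C => f (tens_elt T x y)).
Proof. exact: bhom_comp (lfun_bhom _) (lfun_bhom f). Qed.

Definition linhom_curry1 (f : BCD) (x : B) : linhom C D :=
  bhom_lin (bhom_tens_elt x f).

(** Some positive multiple [e *: f] is a morphism, so its transpose under the adjunction is one too;
    dividing by [e] recovers the map. *)
Lemma bhom_linhom_curry1 (f : BCD) : bhom (linhom_curry1 f).
Proof.
have [e e0 ef] := Defs.lfunP f.
have cb := imor_bhom (tens_curry (IMor ef)).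
rewrite (_ : linhom_curry1 f =
  fun x => nninv e *: tens_curry (IMor ef) x); first exact: bhomZ.
rewrite funeqE => x; apply: linhom_ext => y.
by rewrite lfunZ tens_curryE /= cone_scaleK.
Qed.

Definition linhom_curry (f : BCD) : linhom B (linhom C D) :=
  bhom_lin (bhom_linhom_curry1 f).

Lemma linhom_curryE f x y : linhom_curry f x y = f (tens_elt T x y).
Proof. by []. Qed.

Lemma linhom_curry_linear : cone_linear linhom_curry.
Proof. by split=> [a f|f g]; apply: linhom_ext => x; apply: linhom_ext. Qed.

Lemma linhom_curry_imor : is_icone_mor linhom_curry.
Proof.
have cb : cbounded linhom_curry 1.
  split=> // f; rewrite mul1r; apply: linhom_norm_le.
  split=> [|x]; first exact: cnorm_ge0.
  apply: linhom_norm_le; split=> [|y]; first by rewrite mulr_ge0 ?cnorm_ge0.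
  apply: le_trans ((lfun_bound f).2 _) _.
  by rewrite -mulrA ler_wpM2l ?cnorm_ge0// tens_elt_norm.
apply/icone_morP; split=> //; apply: bhom_test_pullback cb _.
  exact: linhom_curry_linear.
move=> X _ [g [_ [gp g1 [h [m [hp h1 tm ->]]] ->]]].
exists (fun r => tens_elt T (g r) (h r)), m; split=> //.
  exact: tens_elt_path.
(* Tests of a linear hom only use paths in the unit ball. *)
move=> r; apply: le_trans (tens_elt_norm _ _) _.
by apply: mulr_ile1; rewrite ?cnorm_ge0.
Qed.

(** A common scaling brings [f] and [g] into the unit ball, where the adjunction is injective. *)
Lemma linhom_curry_inj : injective linhom_curry.
Proof.
suff main (a : nnreal R) (f g : BCD) : 0 < nnval a ->
    is_icone_mor (a *: f) -> is_icone_mor (a *: g) ->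
    linhom_curry f = linhom_curry g -> f = g.
  move=> f g.
  (* This bounds both norms; the summand 1 keeps it positive when both vanish. *)
  have n0 : 0 < 1 + (cnorm f + cnorm g) by rewrite ltr_pwDl ?addr_ge0 ?cnorm_ge0.
  have ball (h : BCD) : cnorm h <= 1 + (cnorm f + cnorm g) ->
      is_icone_mor (nninv (nn (ltW n0)) *: h).
    by move=> hn; apply: bhom_ball_imor; rewrite cnormZ /= ler_pdivrMl ?mulr1.
  apply: (main (nninv (nn (ltW n0)))); first by rewrite /= invr_gt0.
    by apply: ball; rewrite addrCA lerDl addr_ge0 ?cnorm_ge0.
  by apply: ball; rewrite addrA lerDr addr_ge0 ?cnorm_ge0.
move=> a0 af ag fg.
have : tens_curry (IMor af) = tens_curry (IMor ag).
  apply: imor_ext => x; apply: linhom_ext => y; rewrite !tens_curryE /=.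
  by rewrite -!linhom_curryE fg.
move=> /(bij_inj (tens_curry_bij _ _ _ _)) /(congr1 (@imap _ _ _ _)) h.
apply: linhom_ext => z; rewrite -[f z](cone_scaleK _ a0) -[g z](cone_scaleK _ a0).
by congr (_ *: _); exact: (congr1 (@^~ z) h).
Qed.

(** A nonzero [g] is normalized, uncurried as a morphism and scaled back by [cnorm g]. Morphisms
    have norm at most 1, whence the bound, which makes the inverse a contraction. *)
Lemma linhom_curry_surj (g : linhom B (linhom C D)) :
  exists2 f, linhom_curry f = g & cnorm f <= cnorm g.
Proof.
have [g0|/cone_normalize[a [g' [a0 gE g1 aE]]]] := eqVneq (cnorm g) 0.
  exists 0; last by rewrite cnorm0 g0.
  by rewrite (cnorm_eq0 _ g0) (cone_lin0 linhom_curry_linear).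
have [uncurry _ uncurryK] := tens_curry_bij T B C D.
pose f := uncurry (IMor (bhom_ball_imor g1)).
exists (a *: bhom_lin (imor_bhom f)).
  apply: linhom_ext => x; apply: linhom_ext => y.
  by rewrite linhom_curryE gE !lfunZ /= -tens_curryE uncurryK.
rewrite cnormZ -[leRHS]aE ler_piMr ?nnval_ge0//; apply: linhom_norm_le.
by split=> // z; rewrite mul1r; exact: imor_le.
Qed.



(** The preimage is unique by [linhom_curry_inj]; extracting it from [linhom_curry_surj] keeps its
    norm bound at hand. *)
Definition linhom_uncurry (g : linhom B (linhom C D)) : BCD :=
  s2val (cid2 (linhom_curry_surj g)).

Lemma linhom_uncurryK : cancel linhom_uncurry linhom_curry.
Proof. by move=> g; exact: s2valP (cid2 (linhom_curry_surj g)). Qed.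

Lemma linhom_curryK : cancel linhom_curry linhom_uncurry.
Proof. by move=> f; apply: linhom_curry_inj; rewrite linhom_uncurryK. Qed.

Lemma linhom_uncurryE g x y : linhom_uncurry g (tens_elt T x y) = g x y.
Proof. by rewrite -linhom_curryE linhom_uncurryK. Qed.

Lemma linhom_uncurry_le g : cnorm (linhom_uncurry g) <= cnorm g.
Proof. exact: s2valP' (cid2 (linhom_curry_surj g)). Qed.

Lemma linhom_uncurry_linear : cone_linear linhom_uncurry.
Proof.
have [cZ cD] := linhom_curry_linear.
by split=> [a f|f g]; apply: linhom_curry_inj; rewrite ?cZ ?cD !linhom_uncurryK.
Qed.

End Curry.

(** * The inverse as a morphism of integrable cones *)

Section UncurryMorphism.
Context (R : realType) (Ar : arity_cat) (T : tensor R Ar).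
Context (B C D : iconeType R Ar).

(* A path of bilinear maps is a single bilinear map valued in the cone of
   paths, so the adjunction for [mpath X D] uncurries the whole path at once. *)
Lemma linhom_uncurry_path : pres_paths (@linhom_uncurry R Ar T B C D).
Proof.
move=> X e ep.
(* The inner swap moves [X] past [B]; the second one, composed after it, moves [X] past [C]. *)
pose g := bhom_lin (bhom_comp
  (lfun_bhom (path_linhom_swap (MPath ep))) (bhom_path_linhom_swap X C D)).
rewrite (_ : (fun r => _) = linhom_path_eval (linhom_uncurry T g)).
  exact: linhom_path_eval_path.
(* Both sides have the same currying: each takes the value [e r x y] at [tens_elt T x y]. *)
rewrite funeqE => r; apply: linhom_curry_inj; rewrite linhom_uncurryK.
apply: linhom_ext => x; apply: linhom_ext => y.
by rewrite linhom_curryE /= linhom_uncurryE.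
Qed.

Lemma linhom_uncurry_imor : is_icone_mor (@linhom_uncurry R Ar T B C D).
Proof.
have ul := @linhom_uncurry_linear R Ar T B C D.
have [cl cc _ _ ci] := linhom_curry_imor T B C D.
have ub : cbounded (@linhom_uncurry R Ar T B C D) 1.
  by split=> // g; rewrite mul1r; exact: linhom_uncurry_le.
apply/icone_morP; split=> //; split=> //.
- split=> [g h|u M g iu uM ug]; first exact: (cone_lin_le ul).
  (* Currying and its inverse are both monotone, so an upper bound of the images curries to an upper
     bound of [u]. *)
  split=> [n|f uf]; first exact/(cone_lin_le ul)/ug.1.
  rewrite -[f]linhom_curryK; apply: (cone_lin_le ul); apply: ug.2 => n.
  by rewrite -[u n](linhom_uncurryK T); exact: cc.1.
- by exists 1.
- exact: linhom_uncurry_path.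
- move=> X e mu g ep eg; have uep := linhom_uncurry_path ep.
  (* The uncurried path has an integral [f]; currying preserves integrals, so [f] curries to the
     integral of [e], which is [g] by uniqueness. *)
  have [f ef] := integral_ex X _ mu uep.
  suff <- : f = linhom_uncurry T g by [].
  apply: (linhom_curry_inj (T := T)); rewrite linhom_uncurryK.
  apply: cint_uniq eg; have := ci _ _ _ _ uep ef.
  by under eq_fun do rewrite linhom_uncurryK.
Qed.

End UncurryMorphism.

Theorem theorem5p12 (R : realType) (Ar : arity_cat) (T : tensor R Ar)
    (B C D : iconeType R Ar) :
  exists Phi : imor (linhom (tens T B C) D) (linhom B (linhom C D)),
    (forall (f : linhom (tens T B C) D) (x : B) (y : C),
       Phi f x y = f (tens_elt T x y)) /\
    is_icone_iso Phi.
Proof.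
exists (IMor (linhom_curry_imor T B C D)); split=> //.
exists (IMor (linhom_uncurry_imor T B C D)); split; apply: imor_ext.
  exact: linhom_curryK.
exact: linhom_uncurryK.
Qed.
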